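(* Let $K$ be a field of characteristic different from $2$ and $3$ and let $(M,[\,,\,],A)$ be an Akivis superalgebra over $K$. Then the $\mathbb{Z}$-graded superalgebras $V(M)$ and $\mathrm{gr}\,\tilde U(M)$ (defined in the context) are isomorphic.
   Context: A superalgebra is a (not necessarily associative) $\mathbb{Z}_2$-graded algebra over $K$. A $\mathbb{Z}$-graded superalgebra is a superalgebra that also has a compatible $\mathbb{Z}$-grading as an algebra; isomorphisms respect both gradings. Akivis superalgebra: a supervector space $M=M_0\oplus M_1$ with (i) a bilinear map $[\,,\,]$ making $M$ a superalgebra ($[M_\alpha,M_\beta]\subseteq M_{\alpha+\beta}$) that is superanticommutative ($[x,y]=-(-1)^{\alpha\beta}[y,x]$ for $x\in M_\alpha,y\in M_\beta$), and (ii) a trilinear map $A:M\times M\times M\to M$ with $A(M_\alpha,M_\beta,M_\gamma)\subseteq M_{\alpha+\beta+\gamma}$, such that for all $x\in M_\alpha,y\in M_\beta,z\in M_\gamma$, $$[[x,y],z]+(-1)^{\alpha(\beta+\gamma)}[[y,z],x]+(-1)^{\gamma(\alpha+\beta)}[[z,x],y]=A(x,y,z)+(-1)^{\alpha(\beta+\gamma)}A(y,z,x)+(-1)^{\gamma(\alpha+\beta)}A(z,x,y)-(-1)^{\alpha\beta}A(y,x,z)-(-1)^{\alpha(\beta+\gamma)+\beta\gamma}A(z,y,x)-(-1)^{\beta\gamma}A(x,z,y).$$ $\tilde T(M)=\bigoplus_{n\ge 0}\tilde T^n(M)$ is the nonassociative tensor algebra: $\tilde T^0(M)=K$, $\tilde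 T^1(M)=M$, $\tilde T^n(M)=\bigoplus_{i=1}^{n-1}\tilde T^i(M)\otimes\tilde T^{n-i}(M)$ for $n\ge2$, with multiplication $xy=x\otimes y$ (elements of $K$ acting by scalar multiplication) and the $\mathbb{Z}_2$-grading induced from $M$ ($K$ even, parities of tensor factors add). Let $I$ be the two-sided ideal of $\tilde T(M)$ generated by the elements $x\otimes y-(-1)^{\alpha\beta}y\otimes x-[x,y]$ and $(x\otimes y)\otimes z-x\otimes(y\otimes z)-A(x,y,z)$ for $x\in M_\alpha,y\in M_\beta,z\in M_\gamma$, $\alpha,\beta,\gamma\in\mathbb{Z}_2$. Put $\tilde U(M)=\tilde T(M)/I$, a superalgebra with the induced $\mathbb{Z}_2$-grading. Let $\tilde T_n(M)=\bigoplus_{i=0}^n\tilde T^i(M)$ and let $\tilde U_n(M)$ be its image in $\tilde U(M)$. The associated graded superalgebra is $\mathrm{gr}\,\tilde U(M)=\bigoplus_{n\ge0}(\mathrm{gr}\,\tilde U(M))_n$ with $(\mathrm{gr}\,\tilde U(M))_0=K$, $(\mathrm{gr}\,\tilde U(M))_n=\tilde U_n(M)/\tilde U_{n-1}(M)$ for $n\ge1$, multiplication $(a+\tilde U_{i-1}(M))(b+\tilde U_{j-1}(M))=ab+\tilde U_{i+j-1}(M)$ for $a\in\tilde U_i(M),b\in\tilde U_j(M)$, and the induced $\mathbb{Z}_2$-grading. Let $T(M)$ be the usual associative tensor algebra of $M$ and $J$ its ideal generated by $x\otimes y-(-1)^{\alpha\beta}y\otimes x$ for $x\in M_\alpha,y\in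 M_\beta$. $S(M)=T(M)/J=\bigoplus_{n\ge 0} S^n(M)$ is the supersymmetric superalgebra, where $S^n(M)$ is the image of $M^{\otimes n}$, $S^0(M)=K$, $S^1(M)=M$. $V(M)=\bigoplus_{n\ge0}V^n(M)$ is defined by $V^n(M)=S^n(M)$ for $n\le3$ and $V^n(M)=\bigoplus_{i=1}^{n-1}V^i(M)\otimes V^{n-i}(M)$ for $n>3$, with the $\mathbb{Z}_2$-grading induced from $M$. Its multiplication is, for $v_i\in V^i(M),v_j\in V^j(M)$: $v_i\cdot v_j=v_iv_j$ (product in $S(M)$) if $i+j\le3$, and $v_i\cdot v_j=v_i\otimes v_j$ if $i+j>3$ (elements of $V^0(M)=K$ acting by scalar multiplication). *)

(* Defs.v *)
From HB Require Import structures.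
From mathcomp Require Import all_boot all_algebra.
From mathcomp Require Import generic_quotient ring_quotient boolp.

Set Implicit Arguments.
Unset Strict Implicit.
Unset Printing Implicit Defensive.

Import GRing.Theory.
Local Open Scope ring_scope.

Section LinearMaps.
Variables (K : fieldType) (V W X : lmodType K).

Definition bilinear_map (h : V -> W -> X) :=
  (forall w, linear (h^~ w)) /\ (forall v, linear (h v)).

Definition lin_of (f : V -> W) (lf : linear f) : {linear V -> W} :=
  HB.pack f (GRing.isLinear.Build K V W *:%R f lf).

Variables (f : V -> W) (lf : linear f).

Lemma lin0 : f 0 = 0. Proof. exact: (raddf0 (lin_of lf)). Qed.
Lemma linD u v : f (u + v) = f u + f v. Proof. exact: (raddfD (lin_of lf)). Qed.
Lemma linB u v : f (u - v) = f u - f v. Proof. exact: (raddfB (lin_of lf)). Qed.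
Lemma linN u : f (- u) = - f u. Proof. exact: (raddfN (lin_of lf)). Qed.
Lemma linZ a u : f (a *: u) = a *: f u. Proof. by have := lf a u 0; rewrite lin0 !addr0. Qed.
Lemma lin_sum I (r : seq I) (F : I -> V) :
  f (\sum_(i <- r) F i) = \sum_(i <- r) f (F i).
Proof. exact: (raddf_sum (lin_of lf)). Qed.

End LinearMaps.

Lemma linear_comp (K : fieldType) (V W X : lmodType K) (g : W -> X) (f : V -> W) :
  linear g -> linear f -> linear (g \o f).
Proof. by move=> lg lf a u v /=; rewrite lf lg. Qed.

Section Subspaces.
Variables (K : fieldType) (V : lmodType K).

Record subspace := Subspace {
  subspace_pred :> V -> Prop;
  subspace0 : subspace_pred 0;
  subspaceL : forall a u v,
    subspace_pred u -> subspace_pred v -> subspace_pred (a *: u + v)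
}.

Implicit Type P : subspace.

Lemma subspaceD P u v : P u -> P v -> P (u + v).
Proof. by move=> Pu Pv; rewrite -[u]scale1r; apply: subspaceL. Qed.

Lemma subspaceZ P a u : P u -> P (a *: u).
Proof. by move=> Pu; rewrite -[_ *: _]addr0; apply: subspaceL=> //; apply: subspace0. Qed.

Lemma subspaceN P u : P u -> P (- u).
Proof. by move=> Pu; rewrite -scaleN1r; apply: subspaceZ. Qed.

Lemma subspaceB P u v : P u -> P v -> P (u - v).
Proof. by move=> Pu Pv; apply: subspaceD => //; apply: subspaceN. Qed.

Lemma subspace_sum P I (r : seq I) (F : I -> V) :
  (forall i, P (F i)) -> P (\sum_(i <- r) F i).
Proof.
move=> PF; elim: r => [|i r IH]; first by rewrite big_nil; apply: subspace0.
by rewrite big_cons; apply: subspaceD.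
Qed.

Definition full_subspace : subspace :=
  @Subspace (fun=> True) I (fun _ _ _ _ _ => I).

Fact zero_subspaceL a (u v : V) : u = 0 -> v = 0 -> a *: u + v = 0.
Proof. by move=> -> ->; rewrite scaler0 addr0. Qed.
Definition zero_subspace : subspace :=
  @Subspace (fun v => v = 0) erefl zero_subspaceL.

Section Span.
Variable S : V -> Prop.
Definition in_span v := forall P : subspace, (forall u, S u -> P u) -> P v.
Fact in_span0 : in_span 0. Proof. by move=> P _; apply: subspace0. Qed.
Fact in_spanL a u v : in_span u -> in_span v -> in_span (a *: u + v).
Proof. by move=> Su Sv P SP; apply: subspaceL; [apply: Su | apply: Sv]. Qed.
Definition span : subspace := Subspace in_span0 in_spanL.
End Span.

Lemma mem_span S v : S v -> span S v.
Proof. by move=> Sv P; apply. Qed.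

Definition subspace_mem P : {pred V} := fun v => `[< P v >].

Fact subspace_mem_closed P : submod_closed (subspace_mem P).
Proof.
split; first by apply/asboolP; apply: subspace0.
by move=> a u v /asboolP Pu /asboolP Pv; apply/asboolP; apply: subspaceL.
Qed.

HB.instance Definition _ P :=
  GRing.isSubmodClosed.Build K V (subspace_mem P) (subspace_mem_closed P).

Definition subspace_type P : Type := {v : V | v \in subspace_mem P}.
HB.instance Definition _ P := SubChoice.on (subspace_type P).
HB.instance Definition _ P := [SubChoice_isSubLmodule of subspace_type P by <:].

Definition insubspace P v (Pv : P v) : subspace_type P :=
  exist _ v (asboolT Pv).

Lemma val_insubspace P v (Pv : P v) : val (insubspace Pv) = v. Proof. by []. Qed.
Lemma subspace_valP P (v : subspace_type P) : P (val v).
Proof. by apply/asboolP; exact: (valP v). Qed.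

Lemma subspace_val_linear P : linear (val : subspace_type P -> V).
Proof. exact: linearP. Qed.

End Subspaces.

Section Quotients.
Variables (K : fieldType) (V : lmodType K) (P : subspace V).
Local Open Scope quotient_scope.

Definition quotient : Type := {ideal_quot (subspace_mem P)}.
HB.instance Definition _ := GRing.Zmodule.on quotient.

Definition qpi (v : V) : quotient := \pi_({ideal_quot (subspace_mem P)}) v.
Definition qrepr (q : quotient) : V := repr (q : {ideal_quot (subspace_mem P)}).

Lemma qreprK q : qpi (qrepr q) = q. Proof. exact: reprK. Qed.

Lemma qpi_eq u v : (qpi u = qpi v) <-> P (u - v).
Proof.
rewrite /qpi; split=> [/eqP|Puv].
  by rewrite -Quotient.idealrBE => /asboolP.
by apply/eqP; rewrite -Quotient.idealrBE; apply/asboolP.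
Qed.

Lemma qpiD u v : qpi (u + v) = qpi u + qpi v.
Proof. exact: (raddfD \pi_({ideal_quot (subspace_mem P)})). Qed.

Definition qscale (a : K) (q : quotient) : quotient := qpi (a *: qrepr q).

Lemma qscaleE a v : qscale a (qpi v) = qpi (a *: v).
Proof.
apply/qpi_eq; rewrite -scalerBr; apply: subspaceZ.
by apply/qpi_eq; rewrite qreprK.
Qed.

Fact qscaleA a b q : qscale a (qscale b q) = qscale (a * b) q.
Proof. by rewrite -[q]qreprK !qscaleE scalerA. Qed.
Fact qscale1 : left_id 1 qscale.
Proof. by move=> q; rewrite -[q]qreprK !qscaleE scale1r. Qed.
Fact qscaleDr : right_distributive qscale +%R.
Proof.
by move=> a p q; rewrite -[p]qreprK -[q]qreprK -qpiD !qscaleE scalerDr qpiD.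
Qed.
Fact qscaleDl q : {morph qscale^~ q : a b / a + b}.
Proof. by move=> a b; rewrite -[q]qreprK !qscaleE scalerDl qpiD. Qed.

HB.instance Definition _ := GRing.Zmodule_isLmodule.Build K quotient
  qscaleA qscale1 qscaleDr qscaleDl.

Lemma qpi_linear : linear qpi.
Proof. by move=> a u v; rewrite qpiD -qscaleE. Qed.

Lemma qpi0 v : qpi v = 0 <-> P v.
Proof. by rewrite -(lin0 qpi_linear) qpi_eq subr0. Qed.

End Quotients.

Section SubspaceMaps.
Variables (K : fieldType) (V W : lmodType K) (f : V -> W) (lf : linear f).

Section Preimage.
Variable P : subspace W.
Fact preimage0 : P (f 0). Proof. by rewrite (lin0 lf); apply: subspace0. Qed.
Fact preimageL a u v : P (f u) -> P (f v) -> P (f (a *: u + v)).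
Proof. by move=> Pu Pv; rewrite lf; apply: subspaceL. Qed.
Definition preimage_subspace : subspace V := Subspace preimage0 preimageL.
End Preimage.

Section Image.
Variable P : subspace V.
Definition in_image w := exists2 v, P v & w = f v.
Fact in_image0 : in_image 0.
Proof. by exists 0; [apply: subspace0 | rewrite (lin0 lf)]. Qed.
Fact in_imageL a u v : in_image u -> in_image v -> in_image (a *: u + v).
Proof.
by move=> [x Px ->] [y Py ->]; exists (a *: x + y); [apply: subspaceL | rewrite lf].
Qed.
Definition image_subspace : subspace W := Subspace in_image0 in_imageL.
End Image.

End SubspaceMaps.

Section DirectSums.
Variables (K : fieldType) (I : choiceType) (V : I -> lmodType K).

Definition dprod : Type := forall i, V i.
HB.instance Definition _ := Choice.copy dprod (forall i, V i).

Definition dprod_add (f g : dprod) : dprod := fun i => f i + g i.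
Definition dprod_opp (f : dprod) : dprod := fun i => - f i.
Definition dprod_zero : dprod := fun i => 0.
Definition dprod_scale (a : K) (f : dprod) : dprod := fun i => a *: f i.

Fact dprod_addA : associative dprod_add.
Proof. by move=> f g h; apply: functional_extensionality_dep => i; apply: addrA. Qed.
Fact dprod_addC : commutative dprod_add.
Proof. by move=> f g; apply: functional_extensionality_dep => i; apply: addrC. Qed.
Fact dprod_add0 : left_id dprod_zero dprod_add.
Proof. by move=> f; apply: functional_extensionality_dep => i; apply: add0r. Qed.
Fact dprod_addN : left_inverse dprod_zero dprod_opp dprod_add.
Proof. by move=> f; apply: functional_extensionality_dep => i; apply: addNr. Qed.
HB.instance Definition _ := GRing.isZmodule.Build dprod
  dprod_addA dprod_addC dprod_add0 dprod_addN.

Fact dprod_scaleA a b f : dprod_scale a (dprod_scale b f) = dprod_scale (a * b) f.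
Proof. by apply: functional_extensionality_dep => i; apply: scalerA. Qed.
Fact dprod_scale1 : left_id 1 dprod_scale.
Proof. by move=> f; apply: functional_extensionality_dep => i; apply: scale1r. Qed.
Fact dprod_scaleDr : right_distributive dprod_scale +%R.
Proof. by move=> a f g; apply: functional_extensionality_dep => i; apply: scalerDr. Qed.
Fact dprod_scaleDl f : {morph dprod_scale^~ f : a b / a + b}.
Proof. by move=> a b; apply: functional_extensionality_dep => i; apply: scalerDl. Qed.
HB.instance Definition _ := GRing.Zmodule_isLmodule.Build K dprod
  dprod_scaleA dprod_scale1 dprod_scaleDr dprod_scaleDl.

Lemma dprodE : (forall i, (0 : dprod) i = 0) *
  (forall (f g : dprod) i, (f + g) i = f i + g i) *
  (forall a (f : dprod) i, (a *: f) i = a *: f i).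
Proof. by []. Qed.

Definition finitely_supported (f : dprod) :=
  exists s : seq I, forall i, f i != 0 -> i \in s.
Fact finitely_supported0 : finitely_supported 0.
Proof. by exists [::] => i; rewrite eqxx. Qed.
Fact finitely_supportedL a f g :
  finitely_supported f -> finitely_supported g -> finitely_supported (a *: f + g).
Proof.
move=> [s sP] [t tP]; exists (s ++ t) => i; rewrite mem_cat !dprodE => nz.
apply/orP; have [fi|/sP] := eqVneq (f i) 0; last by left.
by right; apply: tP; move: nz; rewrite fi scaler0 add0r.
Qed.
Definition finite_support : subspace dprod :=
  Subspace finitely_supported0 finitely_supportedL.

Definition dsum : lmodType K := subspace_type finite_support.

Definition dcoef (i : I) (f : dsum) : V i := val f i.

Lemma dcoef_linear i : linear (dcoef i).
Proof. by []. Qed.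

Lemma dsumP (f g : dsum) : (forall i, dcoef i f = dcoef i g) <-> f = g.
Proof.
split=> [fg|-> //]; apply: val_inj.
exact: functional_extensionality_dep.
Qed.

Definition dinj_fun (i : I) (v : V i) : dprod :=
  fun j => if i =P j is ReflectT e then eq_rect i (fun k => V k : Type) v j e else 0.

Lemma dinj_funE i v : dinj_fun v i = v.
Proof. by rewrite /dinj_fun; case: eqP => // e; rewrite eq_axiomK. Qed.

Lemma dinj_fun0 i j (v : V i) : i != j -> dinj_fun v j = 0.
Proof. by rewrite /dinj_fun; case: eqP. Qed.

Fact dinj_finite i (v : V i) : finite_support (dinj_fun v).
Proof.
exists [:: i] => j; rewrite inE; apply: contraR => ne.
by rewrite dinj_fun0 // eq_sym.
Qed.

Definition dinj (i : I) (v : V i) : dsum := insubspace (dinj_finite v).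

Lemma dcoef_dinj i v : dcoef i (dinj v) = v. Proof. exact: dinj_funE. Qed.
Lemma dcoef_dinj0 i j (v : V i) : i != j -> dcoef j (dinj v) = 0.
Proof. exact: dinj_fun0. Qed.

Lemma dinj_linear i : linear (@dinj i).
Proof.
move=> a u v; apply/dsumP => j; rewrite dcoef_linear.
have [<-|ne] := eqVneq i j; first by rewrite !dcoef_dinj.
by rewrite !dcoef_dinj0 // scaler0 addr0.
Qed.

Fact dsupp_ex (f : dsum) :
  exists s : seq I, uniq s /\ forall i, dcoef i f != 0 -> i \in s.
Proof.
have [s sP] := subspace_valP f; exists (undup s); split; first exact: undup_uniq.
by move=> i fi; rewrite mem_undup; apply: sP.
Qed.

Definition dsupp (f : dsum) : seq I := projT1 (cid (dsupp_ex f)).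
Lemma dsupp_uniq f : uniq (dsupp f). Proof. by rewrite /dsupp; case: cid => ? []. Qed.
Lemma mem_dsupp f i : dcoef i f != 0 -> i \in dsupp f.
Proof. by rewrite /dsupp; case: cid => ? [_ +] /=; apply. Qed.

Definition dlift (W : lmodType K) (h : forall i, V i -> W) (f : dsum) : W :=
  \sum_(i <- dsupp f) h i (dcoef i f).

Section Lift.
Variables (W : lmodType K) (h : forall i, V i -> W).
Hypothesis lh : forall i, linear (@h i).

Lemma dlift_seq (f : dsum) (s : seq I) : uniq s ->
  (forall i, dcoef i f != 0 -> i \in s) ->
  dlift h f = \sum_(i <- s) h (dcoef i f).
Proof.
move=> us sP; rewrite /dlift.
rewrite (bigID (fun i => dcoef i f != 0)) /= [X in _ + X]big1 ?addr0; last first.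
  by move=> i; rewrite negbK => /eqP ->; apply: lin0.
rewrite [RHS](bigID (fun i => dcoef i f != 0)) /= [X in _ = _ + X]big1 ?addr0; last first.
  by move=> i; rewrite negbK => /eqP ->; apply: lin0.
rewrite -[LHS]big_filter -[RHS]big_filter; apply: perm_big.
apply: uniq_perm; rewrite ?filter_uniq ?dsupp_uniq // => i.
by rewrite !mem_filter; case: eqP => //= /eqP nz; rewrite sP ?mem_dsupp.
Qed.

Lemma dlift_linear : linear (dlift h).
Proof.
move=> a f g; pose s := undup (dsupp f ++ dsupp g).
have us : uniq s by apply: undup_uniq.
have sf i : dcoef i f != 0 -> i \in s.
  by move=> nz; rewrite mem_undup mem_cat mem_dsupp.
have sg i : dcoef i g != 0 -> i \in s.
  by move=> nz; rewrite mem_undup mem_cat (mem_dsupp nz) orbT.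
rewrite !(@dlift_seq _ s) //; last first.
  move=> i; rewrite dcoef_linear; have [/eqP z|/sf //] := boolP (dcoef i f == 0).
  by rewrite z scaler0 add0r; apply: sg.
rewrite scaler_sumr -big_split /=; apply: eq_bigr => i _.
by rewrite dcoef_linear lh.
Qed.

Lemma dlift_dinj i v : dlift h (@dinj i v) = h v.
Proof.
rewrite (@dlift_seq _ [:: i]) ?big_seq1 ?dcoef_dinj //.
move=> j; rewrite inE; apply: contraR => ne.
by rewrite dcoef_dinj0 // eq_sym.
Qed.

End Lift.

Lemma dsum_decomp f : f = dlift dinj f.
Proof.
apply/dsumP => j; rewrite /dlift (lin_sum (@dcoef_linear j)).
have [jf|jf] := boolP (j \in dsupp f).
  rewrite (bigD1_seq j) ?dsupp_uniq //= dcoef_dinj big1 ?addr0 // => i ne.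
  by rewrite dcoef_dinj0.
rewrite big1_seq => [|i /= ie]; last first.
  by rewrite dcoef_dinj0 //; apply: contra jf => /eqP <-.
by apply/eqP; apply: contraR jf => nz; apply: mem_dsupp.
Qed.

Lemma dsum_ind (P : subspace dsum) : (forall i v, P (@dinj i v)) -> forall f, P f.
Proof. by move=> Pi f; rewrite (dsum_decomp f); apply: subspace_sum. Qed.

Lemma dsum_ext (W : lmodType K) (f g : dsum -> W) : linear f -> linear g ->
  (forall i v, f (@dinj i v) = g (dinj v)) -> f =1 g.
Proof.
move=> lf lg fg u; rewrite (dsum_decomp u) /dlift (lin_sum lf) (lin_sum lg).
exact: eq_bigr.
Qed.

End DirectSums.

Section TensorProduct.
Variables (K : fieldType) (V W : lmodType K).

Definition free_space : lmodType K :=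
  dsum (fun _ : (V * W)%type => K^o : lmodType K).
Definition free_gen (v : V) (w : W) : free_space :=
  dinj (V := fun _ : (V * W)%type => K^o : lmodType K) (i := (v, w)) 1.

Inductive tensor_rel : free_space -> Prop :=
| TensorRelL a v v' w : tensor_rel
    (free_gen (a *: v + v') w - (a *: free_gen v w + free_gen v' w))
| TensorRelR a v w w' : tensor_rel
    (free_gen v (a *: w + w') - (a *: free_gen v w + free_gen v w')).

Definition tensor : lmodType K := quotient (span tensor_rel).
Definition tens (v : V) (w : W) : tensor := qpi (span tensor_rel) (free_gen v w).

Lemma tens_bilinear : bilinear_map tens.
Proof.
split=> [w a v v'|v a w w']; rewrite -(qpi_linear (span tensor_rel)); apply/qpi_eq.
  by apply: mem_span; apply: TensorRelL.
by apply: mem_span; apply: TensorRelR.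
Qed.

Definition free_lift (X : lmodType K) (h : V -> W -> X) : free_space -> X :=
  dlift (fun (p : (V * W)%type) (c : K^o) => (c : K) *: h p.1 p.2).

Definition tlift (X : lmodType K) (h : V -> W -> X) (t : tensor) : X :=
  free_lift h (qrepr t).

Section Lift.
Variables (X : lmodType K) (h : V -> W -> X).
Hypothesis bh : bilinear_map h.

Let free_lift_lin1 (p : (V * W)%type) :
  linear (fun c : K^o => (c : K) *: h p.1 p.2).
Proof. by move=> a c d; rewrite scalerDl scalerA. Qed.

Lemma free_lift_linear : linear (free_lift h).
Proof. exact: (dlift_linear free_lift_lin1). Qed.

Lemma free_lift_gen v w : free_lift h (free_gen v w) = h v w.
Proof. by rewrite /free_lift /free_gen (dlift_dinj free_lift_lin1) scale1r. Qed.

Lemma free_lift_eq u v :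
  qpi (span tensor_rel) u = qpi (span tensor_rel) v ->
  free_lift h u = free_lift h v.
Proof.
move/qpi_eq => /(_ (preimage_subspace free_lift_linear (zero_subspace X))) H.
apply/eqP; rewrite -subr_eq0 -(linB free_lift_linear); apply/eqP; apply: H.
move=> _ [a v1 v2 w|a v1 w w']; rewrite /= (linB free_lift_linear) free_lift_linear !free_lift_gen.
  by rewrite (bh.1 w) subrr.
by rewrite (bh.2 v1) subrr.
Qed.

Lemma tlift_qpi u : tlift h (qpi (span tensor_rel) u) = free_lift h u.
Proof. by apply: free_lift_eq; rewrite qreprK. Qed.

Lemma tlift_linear : linear (tlift h).
Proof.
move=> a s t; rewrite -[s]qreprK -[t]qreprK -(qpi_linear (span tensor_rel)).
by rewrite !tlift_qpi free_lift_linear.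
Qed.

Lemma tlift_tens v w : tlift h (tens v w) = h v w.
Proof. by rewrite tlift_qpi free_lift_gen. Qed.

End Lift.

Lemma tensor_ind (P : subspace tensor) : (forall v w, P (tens v w)) -> forall t, P t.
Proof.
move=> PT t; rewrite -[t]qreprK.
apply: (dsum_ind (P := preimage_subspace (qpi_linear (span tensor_rel)) P)).
move=> [v w] c /=.
have -> : dinj (V := fun _ : (V * W)%type => K^o : lmodType K) (i := (v, w)) c
          = c *: free_gen v w.
  rewrite /free_gen -(linZ (@dinj_linear _ _ (fun _ : (V * W)%type => K^o : lmodType K) (v, w))).
  by congr dinj; rewrite /GRing.scale /= mulr1.
by rewrite (linZ (qpi_linear _)); apply: subspaceZ; apply: PT.
Qed.

Lemma tensor_ext (X : lmodType K) (f g : tensor -> X) : linear f -> linear g ->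
  (forall v w, f (tens v w) = g (tens v w)) -> f =1 g.
Proof.
move=> lf lg fg t.
have lfg : linear (fun t => f t - g t).
  by move=> a u v; rewrite lf lg scalerBr opprD addrACA.
apply/eqP; rewrite -subr_eq0; apply/eqP.
apply: (tensor_ind (P := preimage_subspace lfg (zero_subspace X))) => v w /=.
by rewrite fg subrr.
Qed.

End TensorProduct.

Section SuperSpaces.
Variable K : fieldType.

(* Parities are booleans: Z_2 is represented by bool, its addition by (+) and  *)
(* its multiplication by &&.                                                   *)
Record superspace := Superspace {
  carrier :> lmodType K;
  parity : bool -> subspace carrier;
  parity_decomp : forall v, exists v0 v1,
    [/\ parity false v0, parity true v1 & v = v0 + v1];
  parity_direct : forall v, parity false v -> parity true v -> v = 0
}.

Definition homogeneous_subspace (V : superspace) (P : subspace V) :=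
  forall v, P v -> exists v0 v1,
    [/\ parity V false v0, parity V true v1, P v0, P v1 & v = v0 + v1].

Section Projections.
Variable V : superspace.

Lemma parity_unique (u0 u1 v0 v1 : V) :
  parity V false u0 -> parity V true u1 -> parity V false v0 -> parity V true v1 ->
  u0 + u1 = v0 + v1 -> u0 = v0 /\ u1 = v1.
Proof.
move=> p0 p1 q0 q1 e.
have e' : u0 - v0 = v1 - u1.
  by rewrite -[u0](addrK u1) e addrAC [v0 + v1]addrC addrK.
have z : u0 - v0 = 0.
  by apply: parity_direct; [|rewrite e']; apply: subspaceB.
split; apply/eqP; rewrite -subr_eq0 ?z //.
by rewrite -oppr_eq0 opprB -e' z.
Qed.

Fact pproj_ex v : exists p : V * V,
  [/\ parity V false p.1, parity V true p.2 & v = p.1 + p.2].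
Proof. by have [v0 [v1 H]] := parity_decomp v; exists (v0, v1). Qed.

Definition pproj (a : bool) (v : V) : V :=
  let p := projT1 (cid (pproj_ex v)) in if a then p.2 else p.1.

Lemma pprojP a v : parity V a (pproj a v).
Proof. by rewrite /pproj; case: cid => p []; case: a. Qed.

Lemma pprojD v : v = pproj false v + pproj true v.
Proof. by rewrite /pproj; case: cid => p []. Qed.

Lemma pproj_eq (v0 v1 : V) : parity V false v0 -> parity V true v1 ->
  pproj false (v0 + v1) = v0 /\ pproj true (v0 + v1) = v1.
Proof.
move=> p0 p1; apply: parity_unique => //; try exact: pprojP.
by rewrite -pprojD.
Qed.

Lemma pproj_id a b v : parity V b v -> pproj a v = if a == b then v else 0.
Proof.
move=> pv; case: b pv => pv.
  have := pproj_eq (subspace0 _) pv; rewrite add0r => -[e0 e1].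
  by case: a.
have := pproj_eq pv (subspace0 _); rewrite addr0 => -[e0 e1].
by case: a.
Qed.

Lemma pproj_linear a : linear (pproj a).
Proof.
move=> c u v.
have [e0 e1] := pproj_eq (subspaceL c (pprojP false u) (pprojP false v))
                         (subspaceL c (pprojP true u) (pprojP true v)).
have e : c *: u + v = (c *: pproj false u + pproj false v)
                      + (c *: pproj true u + pproj true v).
  by rewrite {1}[u]pprojD {1}[v]pprojD scalerDr addrACA.
by rewrite e; case: a.
Qed.

Lemma pproj_ext (W : lmodType K) (f g : V -> W) : linear f -> linear g ->
  (forall a v, parity V a v -> f v = g v) -> f =1 g.
Proof.
move=> lf lg fg v; rewrite [v]pprojD (linD lf) (linD lg).
by congr (_ + _); apply: fg; apply: pprojP.
Qed.

End Projections.

Lemma image_homogeneous (V W : superspace) (f : V -> W) (lf : linear f)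
    (P : subspace V) : (forall a v, parity V a v -> parity W a (f v)) ->
  homogeneous_subspace P -> homogeneous_subspace (image_subspace lf P).
Proof.
move=> pf hP _ [v Pv ->]; have [v0 [v1 [p0 p1 P0 P1 ->]]] := hP v Pv.
exists (f v0), (f v1); rewrite (linD lf).
by split; [exact: pf | exact: pf | exists v0 | exists v1 |].
Qed.

(* A linear operator q that is the identity on even and zero on odd elements   *)
(* witnesses that the sum of the two parts is direct.                          *)
Lemma direct_by_projection (V : lmodType K) (P0 P1 : subspace V) (q : V -> V) :
  (forall v, P0 v -> q v = v) -> (forall v, P1 v -> q v = 0) ->
  forall v, P0 v -> P1 v -> v = 0.
Proof. by move=> q0 q1 v p0 p1; rewrite -(q0 v p0) q1. Qed.

Section ScalarSuperspace.
Definition scalar_parity (a : bool) : subspace (K^o : lmodType K) :=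
  if a then zero_subspace _ else full_subspace _.
Fact scalar_decomp (v : K^o) : exists v0 v1,
  [/\ scalar_parity false v0, scalar_parity true v1 & v = v0 + v1].
Proof. by exists v, 0; split=> //; rewrite addr0. Qed.
Fact scalar_direct (v : K^o) : scalar_parity false v -> scalar_parity true v -> v = 0.
Proof. by []. Qed.
Definition scalar_superspace : superspace := Superspace scalar_decomp scalar_direct.
End ScalarSuperspace.

Section SubSuperspace.
Variables (V : superspace) (P : subspace V) (hP : homogeneous_subspace P).
Definition sub_parity (a : bool) : subspace (subspace_type P) :=
  preimage_subspace (@subspace_val_linear K V P) (parity V a).
Fact sub_decomp (v : subspace_type P) : exists v0 v1,
  [/\ sub_parity false v0, sub_parity true v1 & v = v0 + v1].
Proof.
have [v0 [v1 [p0 p1 P0 P1 e]]] := hP (subspace_valP v).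
exists (insubspace P0), (insubspace P1); split=> //; exact: val_inj.
Qed.
Fact sub_direct (v : subspace_type P) :
  sub_parity false v -> sub_parity true v -> v = 0.
Proof. by move=> p0 p1; apply: val_inj; apply: parity_direct. Qed.
Definition sub_superspace : superspace := Superspace sub_decomp sub_direct.
End SubSuperspace.

Section QuotientSuperspace.
Variables (V : superspace) (P : subspace V) (hP : homogeneous_subspace P).
Definition quot_parity (a : bool) : subspace (quotient P) :=
  image_subspace (qpi_linear P) (parity V a).
Fact quot_decomp (v : quotient P) : exists v0 v1,
  [/\ quot_parity false v0, quot_parity true v1 & v = v0 + v1].
Proof.
have [v0 [v1 [p0 p1 e]]] := parity_decomp (qrepr v).
exists (qpi P v0), (qpi P v1); split; [by exists v0 | by exists v1 |].
by rewrite -qpiD -e qreprK.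
Qed.
Fact quot_direct (v : quotient P) :
  quot_parity false v -> quot_parity true v -> v = 0.
Proof.
move=> [v0 p0 ->] [v1 p1 /qpi_eq /hP [w0 [w1 [q0 q1 P0 P1 e]]]].
have [-> _] : v0 = w0 /\ - v1 = w1 by apply: parity_unique => //; apply: subspaceN.
exact/qpi0.
Qed.
Definition quot_superspace : superspace := Superspace quot_decomp quot_direct.
End QuotientSuperspace.

Section DirectSumSuperspace.
Variables (I : choiceType) (V : I -> superspace).
Let DV : lmodType K := dsum (fun i => V i : lmodType K).

Definition sdsum_pred (a : bool) (f : DV) := forall i, parity (V i) a (dcoef i f).
Fact sdsum_pred0 a : sdsum_pred a 0. Proof. by move=> i; apply: subspace0. Qed.
Fact sdsum_predL a c u v : sdsum_pred a u -> sdsum_pred a v -> sdsum_pred a (c *: u + v).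
Proof. by move=> pu pv i; rewrite dcoef_linear; apply: subspaceL. Qed.
Definition sdsum_parity (a : bool) : subspace DV :=
  Subspace (@sdsum_pred0 a) (@sdsum_predL a).

Lemma sdsum_parity_dinj a i (v : V i) : parity (V i) a v ->
  sdsum_parity a (dinj (V := fun i => V i : lmodType K) v).
Proof.
move=> pv j; have [<-|ne] := eqVneq i j; first by rewrite dcoef_dinj.
by rewrite dcoef_dinj0 //; apply: subspace0.
Qed.

Fact sdsum_decomp (f : DV) : exists v0 v1,
  [/\ sdsum_parity false v0, sdsum_parity true v1 & f = v0 + v1].
Proof.
pose g a := dlift (fun i v => dinj (V := fun i => V i : lmodType K) (pproj a v)) f.
have pg a : sdsum_parity a (g a).
  by apply: subspace_sum => i; apply: sdsum_parity_dinj; apply: pprojP.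
exists (g false), (g true); split=> //.
rewrite {1}(dsum_decomp f) /g /dlift -big_split /=; apply: eq_bigr => i _.
by rewrite -(linD (@dinj_linear _ _ _ _)) -pprojD.
Qed.
Fact sdsum_direct (f : DV) : sdsum_parity false f -> sdsum_parity true f -> f = 0.
Proof. by move=> p0 p1; apply/dsumP => i; apply: parity_direct. Qed.
Definition dsum_superspace : superspace := Superspace sdsum_decomp sdsum_direct.
End DirectSumSuperspace.

Section TensorSuperspace.
Variables (V W : superspace).

Definition tensor_parity (a : bool) : subspace (tensor V W) :=
  span (fun t => exists b c v w,
    [/\ parity V b v, parity W c w, a = b (+) c & t = tens v w]).

Lemma tensor_parity_tens b c v w : parity V b v -> parity W c w ->
  tensor_parity (b (+) c) (tens v w).
Proof. by move=> pv pw; apply: mem_span; exists b, c, v, w. Qed.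

Fact tensor_decomp (t : tensor V W) : exists v0 v1,
  [/\ tensor_parity false v0, tensor_parity true v1 & t = v0 + v1].
Proof.
pose D t := exists v0 v1,
  [/\ tensor_parity false v0, tensor_parity true v1 & t = v0 + v1].
have D0 : D 0.
  by exists 0, 0; split; rewrite ?addr0 //; apply: subspace0.
have DL a u v : D u -> D v -> D (a *: u + v).
  move=> [u0 [u1 [p0 p1 ->]]] [v0 [v1 [q0 q1 ->]]].
  exists (a *: u0 + v0), (a *: u1 + v1); split; try exact: subspaceL.
  by rewrite scalerDr addrACA.
apply: (tensor_ind (P := Subspace D0 DL)) => v w /=.
have [bl br] := tens_bilinear V W.
exists (tens (pproj false v) (pproj false w) + tens (pproj true v) (pproj true w)).
exists (tens (pproj false v) (pproj true w) + tens (pproj true v) (pproj false w)).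
split.
- by apply: subspaceD; [apply: (@tensor_parity_tens false false)
                       | apply: (@tensor_parity_tens true true)]; apply: pprojP.
- by apply: subspaceD; [apply: (@tensor_parity_tens false true)
                       | apply: (@tensor_parity_tens true false)]; apply: pprojP.
rewrite {1}[v]pprojD {1}[w]pprojD (linD (bl _)) !(linD (br _)) -!addrA; congr (_ + _).
by rewrite [RHS]addrC -!addrA; congr (_ + _).
Qed.

Let even_part (v : V) (w : W) : tensor V W :=
  tens (pproj false v) (pproj false w) + tens (pproj true v) (pproj true w).
Let even_part_bilinear : bilinear_map even_part.
Proof.
have [bl br] := tens_bilinear V W.
split=> [w a v v'|v a w w'].
  by rewrite /even_part !pproj_linear !bl scalerDr addrACA.
by rewrite /even_part !pproj_linear !br scalerDr addrACA.
Qed.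

Fact tensor_direct (t : tensor V W) :
  tensor_parity false t -> tensor_parity true t -> t = 0.
Proof.
have lq := tlift_linear even_part_bilinear.
have [bl br] := tens_bilinear V W.
apply: (direct_by_projection (q := tlift even_part)) => v pv.
  apply/eqP; rewrite -subr_eq0; apply/eqP.
  have lq' : linear (fun t => tlift even_part t - t).
    by move=> a x y; rewrite lq scalerBr opprD addrACA.
  apply: (pv (preimage_subspace lq' (zero_subspace _))) => _ [b [c [x [y [px py e ->]]]]] /=.
  rewrite (tlift_tens even_part_bilinear) /even_part !(pproj_id _ px) !(pproj_id _ py).
  by case: b c e {px py} => [] [] //= _; rewrite ?(lin0 (bl _)) ?(lin0 (br _)) ?addr0 ?add0r subrr.
apply: (pv (preimage_subspace lq (zero_subspace _))) => _ [b [c [x [y [px py e ->]]]]] /=.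
rewrite (tlift_tens even_part_bilinear) /even_part !(pproj_id _ px) !(pproj_id _ py).
by case: b c e {px py} => [] [] //= _; rewrite ?(lin0 (bl _)) ?(lin0 (br _)) ?addr0.
Qed.
Definition tensor_superspace : superspace := Superspace tensor_decomp tensor_direct.
End TensorSuperspace.

End SuperSpaces.

Section SuperAlgebras.
Variable K : fieldType.

(* No associativity and no unit is required. *)
Record superalgebra := Superalgebra {
  superalgebra_space :> superspace K;
  smul : superalgebra_space -> superalgebra_space -> superalgebra_space;
  smul_bilinear : bilinear_map smul;
  smul_parity : forall a b x y, parity superalgebra_space a x ->
    parity superalgebra_space b y -> parity superalgebra_space (a (+) b) (smul x y)
}.

(* Compatibility of the two gradings: the homogeneous components of degree n   *)
(* are graded subspaces for the parity.                                        *)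
Record zgraded_superalgebra := ZGradedSuperalgebra {
  zgraded_algebra :> superalgebra;
  zdegree : int -> subspace zgraded_algebra;
  zdegree_decomp : forall x, exists (s : seq int) (c : int -> zgraded_algebra),
    (forall n, zdegree n (c n)) /\ x = \sum_(n <- s) c n;
  zdegree_direct : forall (s : seq int) (c : int -> zgraded_algebra), uniq s ->
    (forall n, zdegree n (c n)) -> \sum_(n <- s) c n = 0 ->
    forall n, n \in s -> c n = 0;
  zdegree_mul : forall m n x y, zdegree m x -> zdegree n y ->
    zdegree (m + n) (smul x y);
  zdegree_homogeneous : forall n, homogeneous_subspace (zdegree n)
}.

Definition zgraded_isomorphic (A B : zgraded_superalgebra) : Prop :=
  exists f : A -> B,
    [/\ linear f, bijective f, forall x y, f (smul x y) = smul (f x) (f y),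
        forall a x, parity A a x <-> parity B a (f x)
      & forall n x, zdegree A n x <-> zdegree B n (f x)].

Section Ideals.
Variable A : superalgebra.

Definition is_ideal (P : subspace A) :=
  forall x y, P x -> P (smul x y) /\ P (smul y x).

Section Generated.
Variable S : A -> Prop.

Definition in_ideal_gen x :=
  forall P : subspace A, is_ideal P -> (forall s, S s -> P s) -> P x.
Fact in_ideal_gen0 : in_ideal_gen 0.
Proof. by move=> P _ _; apply: subspace0. Qed.
Fact in_ideal_genL a u v : in_ideal_gen u -> in_ideal_gen v -> in_ideal_gen (a *: u + v).
Proof. by move=> Su Sv P iP SP; apply: subspaceL; [apply: Su | apply: Sv]. Qed.
Definition ideal_gen : subspace A := Subspace in_ideal_gen0 in_ideal_genL.

Lemma mem_ideal_gen s : S s -> ideal_gen s.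
Proof. by move=> Ss P _; apply. Qed.

Lemma ideal_gen_ideal : is_ideal ideal_gen.
Proof.
by move=> x y Px; split=> P iP SP; have [] := iP x y (Px P iP SP).
Qed.

Hypothesis hS : forall s, S s -> exists a, parity A a s.

Lemma ideal_gen_homogeneous : homogeneous_subspace ideal_gen.
Proof.
pose Q x := ideal_gen (pproj false x) /\ ideal_gen (pproj true x).
have Q0 : Q 0 by split; rewrite (lin0 (pproj_linear _)); apply: subspace0.
have QL a u v : Q u -> Q v -> Q (a *: u + v).
  by move=> [u0 u1] [v0 v1]; split; rewrite pproj_linear; apply: subspaceL.
have [ml mr] := smul_bilinear A.
have key a b x y : ideal_gen x -> parity A a x ->
    Q (smul x (pproj b y)) /\ Q (smul (pproj b y) x).
  move=> Ix px.
  have [I1 I2] := ideal_gen_ideal (pproj b y) Ix.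
  have p1 := smul_parity px (pprojP b y); have p2 := smul_parity (pprojP b y) px.
  split; split; rewrite ?(pproj_id _ p1) ?(pproj_id _ p2); case: ifP => // _;
    exact: subspace0.
have iQ : is_ideal (Subspace Q0 QL).
  move=> x y [Q0x Q1x]; rewrite /= -/Q.
  have [k1 k1'] := key false false _ y Q0x (pprojP _ _).
  have [k2 k2'] := key false true _ y Q0x (pprojP _ _).
  have [k3 k3'] := key true false _ y Q1x (pprojP _ _).
  have [k4 k4'] := key true true _ y Q1x (pprojP _ _).
  rewrite [x]pprojD [y]pprojD.
  rewrite !(linD (ml _)) !(linD (mr _)).
  by split; do !apply: (@subspaceD _ _ (Subspace Q0 QL)).
move=> x Ix; exists (pproj false x), (pproj true x).
have [q0 q1] : Q x.
  apply: (Ix (Subspace Q0 QL)) => // s Ss.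
  have [a ps] := hS Ss; split; rewrite (pproj_id _ ps); case: ifP => _;
    by [apply: subspace0 | apply: mem_ideal_gen].
by split=> //; [apply: pprojP | apply: pprojP | apply: pprojD].
Qed.

End Generated.

Section Quotient.
Variables (P : subspace A) (hP : homogeneous_subspace P) (iP : is_ideal P).

Definition quot_smul (x y : quot_superspace hP) : quot_superspace hP :=
  qpi P (smul (qrepr x) (qrepr y)).

Lemma quot_smulE x y : quot_smul (qpi P x) (qpi P y) = qpi P (smul x y).
Proof.
have [ml mr] := smul_bilinear A.
apply/qpi_eq.
set x' := qrepr _; set y' := qrepr _.
have Px : P (x' - x) by apply/qpi_eq; rewrite qreprK.
have Py : P (y' - y) by apply/qpi_eq; rewrite qreprK.
have -> : smul x' y' - smul x y = smul (x' - x) y' + smul x (y' - y).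
  by rewrite (linB (ml _)) (linB (mr _)) addrA subrK.
by apply: subspaceD; [have [] := iP y' Px | have [] := iP x Py].
Qed.

Fact quot_smul_bilinear : bilinear_map quot_smul.
Proof.
have [ml mr] := smul_bilinear A.
split=> [w a u v|v a u w].
  rewrite -[w]qreprK -[u]qreprK -[v]qreprK -(qpi_linear P) !quot_smulE.
  by rewrite -(qpi_linear P) ml.
rewrite -[w]qreprK -[u]qreprK -[v]qreprK -(qpi_linear P) !quot_smulE.
by rewrite -(qpi_linear P) mr.
Qed.

Fact quot_smul_parity a b x y : parity (quot_superspace hP) a x ->
  parity (quot_superspace hP) b y ->
  parity (quot_superspace hP) (a (+) b) (quot_smul x y).
Proof.
move=> [u pu ->] [v pv ->]; rewrite quot_smulE.
by exists (smul u v) => //; apply: smul_parity.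
Qed.

Definition quot_superalgebra : superalgebra :=
  Superalgebra quot_smul_bilinear quot_smul_parity.

End Quotient.
End Ideals.

Section GradedSum.
Variable W : nat -> superspace K.

Definition sinj i (x : W i) : dsum_superspace W :=
  dinj (V := fun i => W i : lmodType K) x.

Lemma sinj_linear i : linear (@sinj i).
Proof. exact: (@dinj_linear _ _ (fun i => W i : lmodType K)). Qed.

Lemma sinj_inj i : injective (@sinj i).
Proof.
move=> x y e.
by rewrite -[x](@dcoef_dinj _ _ (fun i => W i : lmodType K)) -/(sinj x) e dcoef_dinj.
Qed.

Lemma sinj_parity a i (x : W i) :
  parity (W i) a x -> parity (dsum_superspace W) a (sinj x).
Proof. exact: sdsum_parity_dinj. Qed.

Definition dsum_degree (n : int) : subspace (dsum_superspace W) :=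
  if n is Posz k then image_subspace (@sinj_linear k) (full_subspace _)
  else zero_subspace _.

(* The product of two homogeneous components is given with values in the whole *)
(* direct sum, so that no identification of W (i + 0) with W i is needed.      *)
Record component_product := ComponentProduct {
  cprod : forall i j, W i -> W j -> dsum_superspace W;
  cprod_bilinear : forall i j, bilinear_map (@cprod i j);
  cprod_parity : forall i j a b (x : W i) (y : W j),
    parity (W i) a x -> parity (W j) b y ->
    parity (dsum_superspace W) (a (+) b) (cprod x y);
  cprod_degree : forall i j (x : W i) (y : W j), dsum_degree (i + j)%N (cprod x y)
}.

Variable cm : component_product.

Definition gsum_mul (f g : dsum_superspace W) : dsum_superspace W :=
  dlift (fun i (x : W i) => dlift (fun j (y : W j) => cprod cm x y) g) f.

Let lr i (x : W i) : forall j, linear (fun y : W j => cprod cm x y).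
Proof. by move=> j; apply: (cprod_bilinear cm i j).2. Qed.
Let ll g i : linear (fun x : W i => dlift (fun j (y : W j) => cprod cm x y) g).
Proof.
move=> a u v; rewrite /dlift scaler_sumr -big_split /=; apply: eq_bigr => j _.
exact: (cprod_bilinear cm i j).1.
Qed.

Lemma gsum_mul_sinj i j (x : W i) (y : W j) : gsum_mul (sinj x) (sinj y) = cprod cm x y.
Proof.
by rewrite /gsum_mul /sinj (dlift_dinj (ll _)) (dlift_dinj (lr _)).
Qed.

Lemma gsum_mul_bilinear : bilinear_map gsum_mul.
Proof.
split=> [g|f]; first exact: (dlift_linear (ll g)).
move=> a u v; rewrite /gsum_mul {1 3 5}/dlift scaler_sumr -big_split /=.
by apply: eq_bigr => i _; apply: (dlift_linear (lr _)).
Qed.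

Fact gsum_mul_parity a b x y : parity (dsum_superspace W) a x ->
  parity (dsum_superspace W) b y -> parity (dsum_superspace W) (a (+) b) (gsum_mul x y).
Proof.
move=> px py; apply: subspace_sum => i; apply: subspace_sum => j.
by apply: cprod_parity; [apply: px | apply: py].
Qed.

Definition gsum_superalgebra : superalgebra :=
  Superalgebra gsum_mul_bilinear gsum_mul_parity.

Fact gsum_decomp (x : dsum_superspace W) :
  exists (s : seq int) (c : int -> dsum_superspace W),
    (forall n, dsum_degree n (c n)) /\ x = \sum_(n <- s) c n.
Proof.
exists (map Posz (dsupp x)).
exists (fun n => if n is Posz k then sinj (dcoef k x : W k) else 0); split.
  by case=> [k|k] //=; exists (dcoef k x).
by rewrite big_map {1}(dsum_decomp x).
Qed.

Fact gsum_direct (s : seq int) (c : int -> dsum_superspace W) : uniq s ->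
  (forall n, dsum_degree n (c n)) -> \sum_(n <- s) c n = 0 ->
  forall n, n \in s -> c n = 0.
Proof.
move=> us dc z [k|k] ks; last exact: dc (Negz k).
have [x _ e] := dc k.
have := congr1 (dcoef (V := fun i => W i : lmodType K) k) z.
rewrite (lin_sum (@dcoef_linear _ _ (fun i => W i : lmodType K) k)).
rewrite (bigD1_seq (Posz k)) //= big1 ?addr0; last first.
  move=> [l|l] ne; last by rewrite (dc (Negz l)).
  by have [y _ ->] := dc l; rewrite /sinj dcoef_dinj0.
by rewrite e dcoef_dinj => ->; rewrite (lin0 (@sinj_linear k)).
Qed.

Fact gsum_degree_mul m n x y : dsum_degree m x -> dsum_degree n y ->
  dsum_degree (m + n) (gsum_mul x y).
Proof.
have [ml mr] := gsum_mul_bilinear.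
case: m => [i|i]; last by move=> ->; rewrite (lin0 (ml _)) => _; apply: subspace0.
case: n => [j|j]; last by move=> _ ->; rewrite (lin0 (mr _)); apply: subspace0.
move=> [u _ ->] [v _ ->]; rewrite gsum_mul_sinj.
exact: cprod_degree.
Qed.

Fact gsum_homogeneous n : homogeneous_subspace (dsum_degree n).
Proof.
case: n => [k|k] x; last first.
  move=> ->; exists 0, 0; rewrite addr0; split=> //; exact: subspace0.
move=> [y _ ->]; exists (sinj (pproj false y)), (sinj (pproj true y)).
split; last first.
- by rewrite -(linD (@sinj_linear k)) -pprojD.
- by exists (pproj true y).
- by exists (pproj false y).
- by apply: sinj_parity; apply: pprojP.
- by apply: sinj_parity; apply: pprojP.
Qed.

Definition gsum : zgraded_superalgebra :=
  @ZGradedSuperalgebra gsum_superalgebra dsum_degree gsum_decomp gsum_direct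
    gsum_degree_mul gsum_homogeneous.

End GradedSum.
End SuperAlgebras.

Section Casts.
Variable K : fieldType.
Variables (V W : superspace K) (e : V = W).

Definition scast (x : V) : W := eq_rect V (fun U : superspace K => U : Type) x W e.

Lemma scast_linear : linear scast.
Proof. by rewrite /scast; case: W / e. Qed.

Lemma scast_parity a x : parity V a x -> parity W a (scast x).
Proof. by rewrite /scast; case: W / e. Qed.

End Casts.

Lemma scastK (K : fieldType) (V W : superspace K) (e : V = W) :
  cancel (scast e) (scast (esym e)).
Proof. by case: W / e. Qed.

Lemma scastVK (K : fieldType) (V W : superspace K) (e : V = W) :
  cancel (scast (esym e)) (scast e).
Proof. by case: W / e. Qed.

Lemma dsum_superspace_eq (K : fieldType) (I : choiceType) (V W : I -> superspace K) :
  (forall i, V i = W i) -> dsum_superspace V = dsum_superspace W.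
Proof. by move=> e; congr dsum_superspace; apply: functional_extensionality_dep. Qed.

(* A graded product in which degree 0 is the ground field, acting by scalar    *)
(* multiplication.                                                             *)
Section UnitalProduct.
Variables (K : fieldType) (W : nat -> superspace K).
Variable e0 : W 0%N = scalar_superspace K.
Variable mul : forall i j, W i.+1 -> W j.+1 -> W (i + j).+2.
Hypothesis mul_bilinear : forall i j, bilinear_map (@mul i j).
Hypothesis mul_parity : forall i j a b x y,
  parity (W i.+1) a x -> parity (W j.+1) b y -> parity _ (a (+) b) (@mul i j x y).

Definition scalar_of (a : W 0%N) : K := scast e0 a.

Definition unital_prod i j : W i -> W j -> dsum_superspace W :=
  match i, j return W i -> W j -> dsum_superspace W with
  | 0%N, _ => fun a y => sinj (scalar_of a *: y)
  | _.+1, 0%N => fun x a => sinj (scalar_of a *: x)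
  | _.+1, _.+1 => fun x y => sinj (mul x y)
  end.

Fact scalar_of_linear (U : lmodType K) (u : U) : linear (fun a => scalar_of a *: u).
Proof.
move=> c a b; rewrite /scalar_of scast_linear scalerDl; congr (_ + _).
by rewrite scalerA.
Qed.

Fact unital_prod_bilinear i j : bilinear_map (@unital_prod i j).
Proof.
have sl k : linear (@sinj K W k) by exact: sinj_linear.
case: i j => [|i] [|j]; split=> [w a u v|v a u w] /=.
- by rewrite scalar_of_linear sl.
- by rewrite scalerDr scalerA mulrC -scalerA sl.
- by rewrite scalar_of_linear sl.
- by rewrite scalerDr scalerA mulrC -scalerA sl.
- by rewrite scalerDr scalerA mulrC -scalerA sl.
- by rewrite scalar_of_linear sl.
- by rewrite (mul_bilinear i j).1 sl.
by rewrite (mul_bilinear i j).2 sl.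
Qed.

Fact scalar_of_parity a x : parity (W 0%N) a x -> a = false \/ scalar_of x = 0.
Proof. by move/(scast_parity e0); case: a => [e|]; [right | left]. Qed.

Fact unital_prod_parity i j a b (x : W i) (y : W j) :
  parity (W i) a x -> parity (W j) b y ->
  parity (dsum_superspace W) (a (+) b) (unital_prod x y).
Proof.
case: i j x y => [|i] [|j] x y px py /=; apply: sinj_parity.
- have [->|->] := scalar_of_parity px; first exact: subspaceZ.
  by rewrite scale0r; apply: subspace0.
- have [->|->] := scalar_of_parity px; first exact: subspaceZ.
  by rewrite scale0r; apply: subspace0.
- have [->|->] := scalar_of_parity py; first by rewrite addbF; apply: subspaceZ.
  by rewrite scale0r; apply: subspace0.
exact: mul_parity.
Qed.

Fact unital_prod_degree i j (x : W i) (y : W j) :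
  dsum_degree W (i + j)%N (unital_prod x y).
Proof.
case: i j x y => [|i] [|j] x y.
- by exists (scalar_of x *: y).
- by exists (scalar_of x *: y).
- by rewrite addn0; exists (scalar_of y *: x).
by rewrite addSn addnS; exists (mul x y).
Qed.

Definition unital_component_product : component_product W :=
  ComponentProduct unital_prod_bilinear unital_prod_parity unital_prod_degree.

End UnitalProduct.

(* The index set {(i, n - i) | 1 <= i <= n - 1}.                               *)
Definition splitting (n : nat) : Type :=
  {p : nat * nat | [&& 0 < p.1, 0 < p.2 & p.1 + p.2 == n]%N}.
HB.instance Definition _ n := Choice.on (splitting n).

Fact splitting_lt1 n (p : splitting n) : ((val p).1 < n)%N.
Proof.
by case: p => -[i j] /= /and3P[i0 j0 /eqP <-]; rewrite -[X in (X < _)%N]addn0 ltn_add2l.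
Qed.
Fact splitting_lt2 n (p : splitting n) : ((val p).2 < n)%N.
Proof.
by case: p => -[i j] /= /and3P[i0 j0 /eqP <-]; rewrite -[X in (X < _)%N]add0n ltn_add2r.
Qed.
Fact split_pair_subproof i j : [&& 0 < i.+1, 0 < j.+1 & i.+1 + j.+1 == (i + j).+2]%N.
Proof. by rewrite addSn addnS /=. Qed.
Definition split_pair i j : splitting (i + j).+2 :=
  exist _ (i.+1, j.+1) (split_pair_subproof i j).

Fact ltn_well_founded : well_founded (fun m n => m < n)%N.
Proof.
have acc m : forall n, (n <= m)%N -> Acc (fun m n => m < n)%N n.
  elim: m => [|m IH] n nm; apply: Acc_intro => k kn.
    by have := leq_trans kn nm; rewrite ltn0.
  by apply: IH; rewrite -ltnS; apply: leq_trans kn nm.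
move=> n; exact: (acc n n (leqnn n)).
Qed.

(* The spaces W^0 = K, W^n = B^n for 1 <= n <= N, and                          *)
(* W^n = \bigoplus_(i = 1 .. n - 1) W^i (x) W^(n - i) for n > N.               *)
Section Tower.
Variables (K : fieldType) (N : nat) (B : nat -> superspace K).

Definition tower_step (n : nat) (rec : forall m, (m < n)%N -> superspace K) :
    superspace K :=
  if n == 0%N then scalar_superspace K else
  if (n <= N)%N then B n else
  dsum_superspace (fun p : splitting n =>
    tensor_superspace (rec _ (splitting_lt1 p)) (rec _ (splitting_lt2 p))).

Definition tower (n : nat) : superspace K :=
  Fix ltn_well_founded (fun=> superspace K) tower_step n.

Lemma towerE n : tower n = tower_step (fun m (_ : (m < n)%N) => tower m).
Proof.
apply: (Fix_eq ltn_well_founded (fun=> superspace K) tower_step) => m f g fg.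
rewrite /tower_step; case: ifP => // _; case: ifP => // _.
by apply: dsum_superspace_eq => p; rewrite !fg.
Qed.

Lemma tower0 : tower 0 = scalar_superspace K.
Proof. by rewrite towerE. Qed.

Lemma tower_base n : (n < N)%N -> tower n.+1 = B n.+1.
Proof. by move=> nN; rewrite towerE /tower_step /= nN. Qed.

Lemma tower_rec n : ~ (n < N)%N ->
  tower n.+1 = dsum_superspace (fun p : splitting n.+1 =>
    tensor_superspace (tower (val p).1) (tower (val p).2)).
Proof. by move=> nN; rewrite towerE /tower_step /= (negbTE (introN idP nN)). Qed.

Variable bm : forall i j, ((i + j).+1 < N)%N -> B i.+1 -> B j.+1 -> B (i + j).+2.
Hypothesis bm_bilinear : forall i j le, bilinear_map (@bm i j le).
Hypothesis bm_parity : forall i j le a b x y,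
  parity (B i.+1) a x -> parity (B j.+1) b y -> parity _ (a (+) b) (@bm i j le x y).

Fact base_lt1 i j : ((i + j).+1 < N -> i < N)%N.
Proof. by apply: leq_trans; rewrite ltnS -addnS leq_addr. Qed.
Fact base_lt2 i j : ((i + j).+1 < N -> j < N)%N.
Proof. by apply: leq_trans; rewrite ltnS -addSn leq_addl. Qed.

(* The product B^i x B^j -> B^(i + j) up to degree N, and x (x) y beyond.      *)
Definition tower_mul i j (x : tower i.+1) (y : tower j.+1) : tower (i + j).+2 :=
  match @idP ((i + j).+1 < N)%N with
  | ReflectT le => scast (esym (tower_base le))
      (bm le (scast (tower_base (base_lt1 le)) x) (scast (tower_base (base_lt2 le)) y))
  | ReflectF nle => scast (esym (tower_rec nle))
      (dinj (V := fun p : splitting (i + j).+2 =>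
                    tensor_superspace (tower (val p).1) (tower (val p).2) : lmodType K)
            (i := split_pair i j) (tens x y))
  end.

Lemma tower_mul_bilinear i j : bilinear_map (@tower_mul i j).
Proof.
rewrite /tower_mul; case: {-}_ / idP => [le|nle]; split=> [w a u v|v a u w].
- by rewrite !scast_linear (bm_bilinear le).1 scast_linear.
- by rewrite !scast_linear (bm_bilinear le).2 scast_linear.
- by rewrite (tens_bilinear _ _).1 dinj_linear scast_linear.
by rewrite (tens_bilinear _ _).2 dinj_linear scast_linear.
Qed.

Lemma tower_mul_parity i j a b x y : parity (tower i.+1) a x ->
  parity (tower j.+1) b y -> parity _ (a (+) b) (tower_mul x y).
Proof.
move=> px py; rewrite /tower_mul; case: {-}_ / idP => [le|nle]; apply: scast_parity.
  by apply: bm_parity; apply: scast_parity.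
exact/(sdsum_parity_dinj (V := fun p : splitting (i + j).+2 =>
         tensor_superspace (tower (val p).1) (tower (val p).2)))/tensor_parity_tens.
Qed.

Definition tower_product : component_product tower :=
  unital_component_product tower0 tower_mul_bilinear tower_mul_parity.

Definition tower_algebra : zgraded_superalgebra K := gsum tower_product.

End Tower.

Section SupersymmetricAlgebra.
Variables (K : fieldType) (M : superspace K).

Fixpoint tensor_power (n : nat) : superspace K :=
  if n is m.+1 then tensor_superspace M (tensor_power m) else scalar_superspace K.

Fixpoint tcat i j : tensor_power i -> tensor_power j -> tensor_power (i + j) :=
  match i return tensor_power i -> tensor_power j -> tensor_power (i + j) with
  | 0%N => fun a y => (a : K) *: y
  | k.+1 => fun x y => tlift (fun m t => tens m (tcat t y)) x
  end.

Fact tcat_bilinear i j : bilinear_map (@tcat i j).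
Proof.
elim: i => [|i [IHl IHr]]; first split=> [y a u v|x a u v] /=.
- by rewrite scalerDl scalerA.
- by rewrite scalerDr scalerA mulrC -scalerA.
have [bl br] := tens_bilinear M (tensor_power (i + j)).
have bt y : bilinear_map (fun (m : M) t => tens m (@tcat i j t y)).
  by split=> [t a m m'|m a t t']; rewrite ?bl ?IHl ?br.
split=> [y|x a u v]; first exact: (tlift_linear (bt y)).
move: x; apply: tensor_ext.
- exact: (tlift_linear (bt (a *: u + v))).
- move=> c s t; rewrite /= !(tlift_linear (bt _)) scalerDr addrACA; congr (_ + _).
  by rewrite scalerDr !scalerA mulrC.
by move=> m t /=; rewrite !(tlift_tens (bt _)) IHr br.
Qed.

Fact tcat_parity i j a b (x : tensor_power i) (y : tensor_power j) :
  parity _ a x -> parity _ b y -> parity _ (a (+) b) (tcat x y).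
Proof.
move=> + py; elim: i x a => [|i IH] x a.
  case: a => /=; last by move=> _; apply: subspaceZ.
  by move=> ->; rewrite scale0r; apply: subspace0.
have [IHl IHr] := tcat_bilinear i j.
have [bl br] := tens_bilinear M (tensor_power (i + j)).
have bt : bilinear_map (fun (m : M) t => tens m (@tcat i j t y)).
  by split=> [t c m m'|m c t t']; rewrite ?bl ?IHl ?br.
move=> /(_ (preimage_subspace (tlift_linear bt)
             (parity (tensor_power (i.+1 + j)) (a (+) b)))); apply.
move=> _ [c [d [m [t [pm pt -> ->]]]]] /=.
by rewrite (tlift_tens bt) -addbA; apply: tensor_parity_tens => //; apply: IH.
Qed.

Definition tensor_prod i j (x : tensor_power i) (y : tensor_power j) :
  dsum_superspace tensor_power := sinj (tcat x y).

Fact tensor_prod_bilinear i j : bilinear_map (@tensor_prod i j).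
Proof.
split=> [y a u v|x a u v]; rewrite /tensor_prod.
  by rewrite (tcat_bilinear i j).1 sinj_linear.
by rewrite (tcat_bilinear i j).2 sinj_linear.
Qed.

Fact tensor_prod_parity i j a b (x : tensor_power i) (y : tensor_power j) :
  parity _ a x -> parity _ b y ->
  parity (dsum_superspace tensor_power) (a (+) b) (tensor_prod x y).
Proof. by move=> px py; apply/sinj_parity/tcat_parity. Qed.

Fact tensor_prod_degree i j (x : tensor_power i) (y : tensor_power j) :
  dsum_degree tensor_power (i + j)%N (tensor_prod x y).
Proof. by exists (tcat x y). Qed.

Definition tensor_algebra : zgraded_superalgebra K :=
  gsum (ComponentProduct tensor_prod_bilinear tensor_prod_parity tensor_prod_degree).

Definition tensor_unit (a : K) : tensor_algebra :=
  sinj (W := tensor_power) (i := 0) a.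
(* M is identified with M (x) K, the first tensor power. *)
Definition tensor_gen (m : M) : tensor_algebra :=
  sinj (W := tensor_power) (i := 1) (tens m (1 : K^o)).

Lemma tensor_gen_parity a m : parity M a m -> parity tensor_algebra a (tensor_gen m).
Proof.
move=> pm; apply: sinj_parity; rewrite -[a]addbF.
exact: tensor_parity_tens.
Qed.

Lemma tensor_unit_linear : linear (tensor_unit : K^o -> _).
Proof. exact: (@sinj_linear _ tensor_power 0). Qed.

Lemma tensor_gen_linear : linear tensor_gen.
Proof.
move=> a u v.
by rewrite /tensor_gen (tens_bilinear M (scalar_superspace K)).1 sinj_linear.
Qed.

Inductive supersymmetric_rel : tensor_algebra -> Prop :=
| SuperSymRel a b (x y : M) : parity M a x -> parity M b y ->
    supersymmetric_rel (smul (tensor_gen x) (tensor_gen y)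
                        - (-1) ^+ (a && b) *: smul (tensor_gen y) (tensor_gen x)).

Fact supersymmetric_rel_parity s :
  supersymmetric_rel s -> exists a, parity tensor_algebra a s.
Proof.
case=> a b x y px py; exists (a (+) b).
apply: subspaceB; first by apply: smul_parity; apply: tensor_gen_parity.
by apply: subspaceZ; rewrite addbC; apply: smul_parity; apply: tensor_gen_parity.
Qed.

Definition supersymmetric_algebra : superalgebra K :=
  quot_superalgebra (ideal_gen_homogeneous supersymmetric_rel_parity)
    (@ideal_gen_ideal K tensor_algebra supersymmetric_rel).

Definition sym_class (t : tensor_algebra) : supersymmetric_algebra :=
  qpi (ideal_gen supersymmetric_rel) t.

Lemma sym_class_linear : linear sym_class.
Proof. exact: (qpi_linear (ideal_gen supersymmetric_rel)). Qed.

Lemma sym_classM t u : sym_class (smul t u) = smul (sym_class t) (sym_class u).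
Proof.
symmetry; exact: (@quot_smulE K tensor_algebra _
  (ideal_gen_homogeneous supersymmetric_rel_parity)
  (@ideal_gen_ideal K tensor_algebra supersymmetric_rel) t u).
Qed.

Lemma sym_class_parity a t :
  parity tensor_algebra a t -> parity supersymmetric_algebra a (sym_class t).
Proof. by move=> pt; exists t. Qed.

(* S^n as the image of the n-th tensor power. *)
Definition sym_image (n : nat) : subspace supersymmetric_algebra :=
  image_subspace sym_class_linear (zdegree tensor_algebra n).

Fact sym_image_homogeneous n : homogeneous_subspace (sym_image n).
Proof. exact: (image_homogeneous (lf := sym_class_linear) sym_class_parity
               (@zdegree_homogeneous K tensor_algebra n)). Qed.

Lemma sym_imageM i j s t : sym_image i s -> sym_image j t ->
  sym_image (i + j) (smul s t).
Proof.
move=> [x dx ->] [y dy ->]; exists (smul x y); last by rewrite sym_classM.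
exact: (zdegree_mul dx dy).
Qed.

(* S^0 = K and S^1 = M are taken literally; sym_val is the map to the algebra. *)
Definition sym_power (n : nat) : superspace K :=
  match n with
  | 0%N => scalar_superspace K
  | 1%N => M
  | _ => sub_superspace (@sym_image_homogeneous n)
  end.

Definition sym_val (n : nat) : sym_power n -> supersymmetric_algebra :=
  match n return sym_power n -> supersymmetric_algebra with
  | 0%N => fun a => sym_class (tensor_unit a)
  | 1%N => fun m => sym_class (tensor_gen m)
  | _ => fun s => val s
  end.

Lemma sym_valP n (s : sym_power n) : sym_image n (sym_val s).
Proof.
case: n s => [|[|n]] s /=; last exact: (@subspace_valP _ _ (sym_image n.+2) s).
  by exists (tensor_unit s) => //; exists s.
by exists (tensor_gen s) => //; exists (tens s (1 : K^o)).
Qed.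

Lemma sym_val_linear n : linear (@sym_val n).
Proof.
case: n => [|[|n]] a u v /=; last exact: (@subspace_val_linear _ _ (sym_image n.+2)).
  by rewrite -sym_class_linear -tensor_unit_linear.
by rewrite -sym_class_linear -tensor_gen_linear.
Qed.

Lemma sym_val_parity n a s : parity (sym_power n) a s ->
  parity supersymmetric_algebra a (sym_val s).
Proof.
case: n s => [|[|n]] s //= ps; apply: sym_class_parity.
  exact: (sinj_parity (W := tensor_power) (i := 0) ps).
exact: tensor_gen_parity.
Qed.

Fact sym_mul_subproof i j (s : sym_power i.+1) (t : sym_power j.+1) :
  sym_image (i + j).+2 (smul (sym_val s) (sym_val t)).
Proof. by have := sym_imageM (sym_valP s) (sym_valP t); rewrite addSn addnS. Qed.

Definition sym_mul i j (s : sym_power i.+1) (t : sym_power j.+1) :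
  sym_power (i + j).+2 := insubspace (sym_mul_subproof s t).

Fact sym_mul_bilinear i j : bilinear_map (@sym_mul i j).
Proof.
have [ml mr] := smul_bilinear supersymmetric_algebra.
split=> [w a u v|v a u w]; apply: val_inj.
  rewrite [RHS](@subspace_val_linear _ _ (sym_image (i + j).+2)).
  by rewrite /sym_mul !val_insubspace (@sym_val_linear i.+1) ml.
rewrite [RHS](@subspace_val_linear _ _ (sym_image (i + j).+2)).
by rewrite /sym_mul !val_insubspace (@sym_val_linear j.+1) mr.
Qed.

Fact sym_mul_parity i j a b (x : sym_power i.+1) (y : sym_power j.+1) :
  parity _ a x -> parity _ b y -> parity _ (a (+) b) (sym_mul x y).
Proof.
by move=> /sym_val_parity px /sym_val_parity py; apply: (smul_parity px py).
Qed.

(* V^n = S^n up to degree 3, with the product of S(M) in these degrees.        *)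
Definition V_algebra : zgraded_superalgebra K :=
  @tower_algebra K 3 sym_power (fun i j _ => @sym_mul i j)
    (fun i j _ => sym_mul_bilinear i j) (fun i j _ => @sym_mul_parity i j).

End SupersymmetricAlgebra.

Section AkivisSuperalgebras.
Variable K : fieldType.

Record akivis_superalgebra := AkivisSuperalgebra {
  akivis_space :> superspace K;
  akivis_bracket : akivis_space -> akivis_space -> akivis_space;
  akivis_triple : akivis_space -> akivis_space -> akivis_space -> akivis_space;
  akivis_bracket_bilinear : bilinear_map akivis_bracket;
  akivis_bracket_parity : forall a b x y, parity akivis_space a x -> parity akivis_space b y ->
    parity akivis_space (a (+) b) (akivis_bracket x y);
  akivis_bracket_anticommutative : forall a b x y,
    parity akivis_space a x -> parity akivis_space b y ->
    akivis_bracket x y = - ((-1) ^+ (a && b) *: akivis_bracket y x);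
  akivis_triple_trilinear : [/\ forall y z, linear (fun x => akivis_triple x y z),
    forall x z, linear (fun y => akivis_triple x y z) & forall x y, linear (fun z => akivis_triple x y z)];
  akivis_triple_parity : forall a b c x y z, parity akivis_space a x ->
    parity akivis_space b y -> parity akivis_space c z ->
    parity akivis_space (a (+) b (+) c) (akivis_triple x y z);
  akivis_identity : forall a b c x y z, parity akivis_space a x ->
    parity akivis_space b y -> parity akivis_space c z ->
    akivis_bracket (akivis_bracket x y) z
      + (-1) ^+ (a && (b (+) c)) *: akivis_bracket (akivis_bracket y z) x
      + (-1) ^+ (c && (a (+) b)) *: akivis_bracket (akivis_bracket z x) y
    = akivis_triple x y z
      + (-1) ^+ (a && (b (+) c)) *: akivis_triple y z x
      + (-1) ^+ (c && (a (+) b)) *: akivis_triple z x y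
      - (-1) ^+ (a && b) *: akivis_triple y x z
      - (-1) ^+ ((a && (b (+) c)) (+) (b && c)) *: akivis_triple z y x
      - (-1) ^+ (b && c) *: akivis_triple x z y
}.

Section NonassociativeTensorAlgebra.
Variable M : superspace K.

(* No product of two elements of positive degree stays below degree 2. *)
Definition no_mul i j (le : ((i + j).+1 < 1)%N) (_ _ : M) : M :=
  False_rect M (notF le).

Fact no_mul_bilinear i j le : bilinear_map (@no_mul i j le).
Proof. by []. Qed.
Fact no_mul_parity i j le a b x y : parity M a x -> parity M b y ->
  parity M (a (+) b) (@no_mul i j le x y).
Proof. by []. Qed.

Definition nonassociative_product : component_product (tower 1 (fun=> M)) :=
  tower_product no_mul_bilinear no_mul_parity.

Definition nonassociative_tensor_algebra : zgraded_superalgebra K :=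
  gsum nonassociative_product.

Local Notation T := nonassociative_tensor_algebra.

Definition tgen (x : M) : T :=
  sinj (scast (esym (@tower_base K 1 (fun=> M) 0 isT)) x).

Lemma tgen_linear : linear tgen.
Proof. by move=> a u v; rewrite /tgen scast_linear sinj_linear. Qed.

Lemma tgen_parity a x : parity M a x -> parity T a (tgen x).
Proof. by move=> px; apply/sinj_parity/scast_parity. Qed.

(* T_n = \bigoplus_(i <= n) T^i *)
Definition tensor_filtration_pred (n : nat) (f : T) :=
  forall i, (n < i)%N ->
    dcoef (V := fun i => tower 1 (fun=> M) i : lmodType K) i f = 0.
Fact tensor_filtration0 n : tensor_filtration_pred n 0.
Proof. by []. Qed.
Fact tensor_filtrationL n a f g : tensor_filtration_pred n f ->
  tensor_filtration_pred n g -> tensor_filtration_pred n (a *: f + g).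
Proof.
by move=> pf pg i ni; rewrite dcoef_linear pf // pg // scaler0 addr0.
Qed.
Definition tensor_filtration n : subspace T :=
  Subspace (@tensor_filtration0 n) (@tensor_filtrationL n).

Fact tensor_filtration_homogeneous n : homogeneous_subspace (tensor_filtration n).
Proof.
move=> f nf; exists (pproj false f), (pproj true f).
have cf i : dcoef (V := fun i => tower 1 (fun=> M) i : lmodType K) i (pproj false f)
            + dcoef (V := fun i => tower 1 (fun=> M) i : lmodType K) i (pproj true f)
            = dcoef (V := fun i => tower 1 (fun=> M) i : lmodType K) i f.
  by rewrite {3}[f]pprojD.
have z i : (n < i)%N ->
    dcoef (V := fun i => tower 1 (fun=> M) i : lmodType K) i (pproj false f) = 0 /\
    dcoef (V := fun i => tower 1 (fun=> M) i : lmodType K) i (pproj true f) = 0.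
  move=> ni; apply: (@parity_unique _ (tower 1 (fun=> M) i)).
  - exact: (pprojP false f i).
  - exact: (pprojP true f i).
  - exact: subspace0.
  - exact: subspace0.
  by rewrite cf nf // addr0.
split; try exact: pprojP; last exact: pprojD.
  by move=> i /z [].
by move=> i /z [].
Qed.

Lemma tensor_filtrationM i j x y : tensor_filtration i x -> tensor_filtration j y ->
  tensor_filtration (i + j) (smul x y).
Proof.
move=> fx fy; apply: subspace_sum => k; apply: subspace_sum => l.
have [ki|ik] := leqP k i; last first.
  by rewrite fx // (lin0 ((cprod_bilinear _ k l).1 _)); apply: subspace0.
have [lj|jl] := leqP l j; last first.
  by rewrite fy // (lin0 ((cprod_bilinear _ k l).2 _)); apply: subspace0.
set u := dcoef _ _; set v := dcoef _ _.
have [w _ ->] := cprod_degree nonassociative_product u v.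
move=> m ijm; rewrite /sinj dcoef_dinj0 //.
by rewrite neq_ltn (leq_ltn_trans (leq_add ki lj) ijm).
Qed.

Lemma tensor_filtrationS n x : tensor_filtration n x -> tensor_filtration n.+1 x.
Proof. by move=> nx i ni; apply: nx; apply: ltnW. Qed.

End NonassociativeTensorAlgebra.

Section Enveloping.
Variable M : akivis_superalgebra.
Local Notation T := (nonassociative_tensor_algebra M).
Local Notation t := (@tgen M).

Inductive enveloping_rel : T -> Prop :=
| CommutatorRel a b (x y : M) : parity M a x -> parity M b y ->
    enveloping_rel (smul (t x) (t y) - (-1) ^+ (a && b) *: smul (t y) (t x)
                    - t (akivis_bracket x y))
| AssociatorRel a b c (x y z : M) : parity M a x -> parity M b y -> parity M c z ->
    enveloping_rel (smul (smul (t x) (t y)) (t z) - smul (t x) (smul (t y) (t z))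
                    - t (akivis_triple x y z)).

Fact enveloping_rel_parity s : enveloping_rel s -> exists a, parity T a s.
Proof.
case=> [a b x y px py|a b c x y z px py pz].
  exists (a (+) b); apply: subspaceB; last by apply/tgen_parity/akivis_bracket_parity.
  apply: subspaceB; first by apply: smul_parity; apply: tgen_parity.
  by apply: subspaceZ; rewrite addbC; apply: smul_parity; apply: tgen_parity.
exists (a (+) b (+) c); apply: subspaceB; last by apply/tgen_parity/akivis_triple_parity.
apply: subspaceB; last rewrite -addbA;
  by do ![apply: smul_parity | apply: tgen_parity].
Qed.

Definition enveloping_ideal : subspace T := ideal_gen enveloping_rel.

Definition enveloping_algebra : superalgebra K :=
  quot_superalgebra (ideal_gen_homogeneous enveloping_rel_parity)
    (@ideal_gen_ideal K T enveloping_rel).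

Local Notation U := enveloping_algebra.

Definition env_class (x : T) : U := qpi enveloping_ideal x.

Lemma env_class_linear : linear env_class.
Proof. exact: (qpi_linear enveloping_ideal). Qed.

Lemma env_classM x y : env_class (smul x y) = smul (env_class x) (env_class y).
Proof.
symmetry; exact: (@quot_smulE K T _
  (ideal_gen_homogeneous enveloping_rel_parity)
  (@ideal_gen_ideal K T enveloping_rel) x y).
Qed.

Lemma env_class_parity a x : parity T a x -> parity U a (env_class x).
Proof. by move=> px; exists x. Qed.

Definition env_filtration (n : nat) : subspace U :=
  image_subspace env_class_linear (tensor_filtration M n).

Fact env_filtration_homogeneous n : homogeneous_subspace (env_filtration n).
Proof.
exact: (image_homogeneous (lf := env_class_linear) env_class_parity
          (@tensor_filtration_homogeneous M n)).
Qed.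

Lemma env_filtrationM i j x y : env_filtration i x -> env_filtration j y ->
  env_filtration (i + j) (smul x y).
Proof.
move=> [u fu ->] [v fv ->]; exists (smul u v); last by rewrite env_classM.
exact: tensor_filtrationM.
Qed.

Lemma env_filtrationS n x : env_filtration n x -> env_filtration n.+1 x.
Proof. by move=> [u fu ->]; exists u => //; apply: tensor_filtrationS. Qed.

Definition env_space (n : nat) : superspace K :=
  sub_superspace (@env_filtration_homogeneous n).

(* U_n as a subspace of U_(n+1) *)
Definition env_previous (n : nat) : subspace (env_space n.+1) :=
  preimage_subspace (@subspace_val_linear K U (env_filtration n.+1)) (env_filtration n).

Fact env_previous_homogeneous n : homogeneous_subspace (env_previous n).
Proof.
move=> v /env_filtration_homogeneous [v0 [v1 [p0 p1 f0 f1 e]]].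
exists (insubspace (env_filtrationS f0)), (insubspace (env_filtrationS f1)).
by split=> //; apply: val_inj.
Qed.

(* Degree 0 is K itself; degree n > 0 is U_n / U_(n-1). *)
Definition gr (n : nat) : superspace K :=
  if n is m.+1 then quot_superspace (@env_previous_homogeneous m)
  else scalar_superspace K.

Fact gr_mul_subproof i j (x : env_space i.+1) (y : env_space j.+1) :
  env_filtration (i + j).+2 (smul (val x) (val y)).
Proof.
by have := env_filtrationM (subspace_valP x) (subspace_valP y); rewrite addSn addnS.
Qed.

Definition env_mul i j (x : env_space i.+1) (y : env_space j.+1) :
  env_space (i + j).+2 := insubspace (gr_mul_subproof x y).

Definition gr_mul i j (x : gr i.+1) (y : gr j.+1) : gr (i + j).+2 :=
  qpi (env_previous (i + j).+1) (env_mul (qrepr x) (qrepr y)).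

Lemma gr_mulE i j (x : env_space i.+1) (y : env_space j.+1) :
  gr_mul (qpi (env_previous i) x) (qpi (env_previous j) y)
  = qpi (env_previous (i + j).+1) (env_mul x y).
Proof.
have [ml mr] := smul_bilinear U.
apply/qpi_eq; set x' := qrepr _; set y' := qrepr _.
have Px : env_previous i (x' - x) by apply/qpi_eq; rewrite qreprK.
have Py : env_previous j (y' - y) by apply/qpi_eq; rewrite qreprK.
change (env_filtration (i + j).+1 (val (env_mul x' y' - env_mul x y))).
rewrite (linB (@subspace_val_linear _ _ (env_filtration (i + j).+2))) !val_insubspace.
have -> : smul (val x') (val y') - smul (val x) (val y)
          = smul (val (x' - x)) (val y') + smul (val x) (val (y' - y)).
  rewrite (linB (@subspace_val_linear _ _ (env_filtration i.+1))).
  rewrite (linB (@subspace_val_linear _ _ (env_filtration j.+1))).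
  by rewrite (linB (ml _)) (linB (mr _)) addrA subrK.
apply: subspaceD.
  by have := env_filtrationM Px (subspace_valP y'); rewrite addnS.
by have := env_filtrationM (subspace_valP x) Py; rewrite addSn.
Qed.

Fact gr_mul_bilinear i j : bilinear_map (@gr_mul i j).
Proof.
have [ml mr] := smul_bilinear U.
split=> [w a u v|v a u w].
  rewrite -[w]qreprK -[u]qreprK -[v]qreprK -(qpi_linear (env_previous i)) !gr_mulE.
  rewrite -(qpi_linear (env_previous (i + j).+1)); congr qpi; apply: val_inj.
  rewrite [RHS](@subspace_val_linear _ _ (env_filtration (i + j).+2)) !val_insubspace.
  by rewrite (@subspace_val_linear _ _ (env_filtration i.+1)) ml.
rewrite -[w]qreprK -[u]qreprK -[v]qreprK -(qpi_linear (env_previous j)) !gr_mulE.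
rewrite -(qpi_linear (env_previous (i + j).+1)); congr qpi; apply: val_inj.
rewrite [RHS](@subspace_val_linear _ _ (env_filtration (i + j).+2)) !val_insubspace.
by rewrite (@subspace_val_linear _ _ (env_filtration j.+1)) mr.
Qed.

Fact gr_mul_parity i j a b (x : gr i.+1) (y : gr j.+1) :
  parity _ a x -> parity _ b y -> parity _ (a (+) b) (gr_mul x y).
Proof.
move=> [u pu ->] [v pv ->]; rewrite gr_mulE; exists (env_mul u v) => //.
exact: (smul_parity pu pv).
Qed.

Definition gr_algebra : zgraded_superalgebra K :=
  gsum (unital_component_product (W := gr) erefl gr_mul_bilinear gr_mul_parity).

End Enveloping.
End AkivisSuperalgebras.

(* Main.v *)
(* The free nonassociative algebra T~(M) maps onto V(M) by a graded         *)
(* homomorphism pi, and onto gr U~(M) by classes. The relations of U~(M)    *)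
(* make gr U~(M) supercommutative and associative on three generators, so   *)
(* the second map factors as rho o pi with rho : V(M) -> gr U~(M) a         *)
(* surjective homomorphism. For the injectivity of rho, the product of V(M) *)
(* is deformed, by terms of lower degree which only involve components of   *)
(* degree 1 and 2, into a product satisfying the relations of U~(M): the    *)
(* associator of x * y = x y + [x, y] / 2 has to be corrected to A by f - g *)
(* with f and g trilinear, f supersymmetric in its first two and g in its   *)
(* last two arguments. As 6 is invertible, f and g exist as soon as a       *)
(* super-alternating sum vanishes, which is the Akivis identity. The        *)
(* resulting linear map T~(M) -> V(M) kills the ideal and has leading term  *)
(* pi, so that pi kills every element of degree n whose class lies in       *)
(* U~_(n-1).                                                                *)
Require Import Defs.
From HB Require Import structures.
From mathcomp Require Import all_boot all_algebra.
From mathcomp Require Import boolp ring zify.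

Set Implicit Arguments.
Unset Strict Implicit.
Unset Printing Implicit Defensive.

Import GRing.Theory.
Local Open Scope ring_scope.

(** * Towers and graded products *)

(** The algebra V(M) is universal among unital nonassociative algebras receiving a linear map from M
    whose values supercommute and satisfy (xy)z = x(yz) ([V_algebra_lift]). This combines the
    recursive universal property of towers ([tower_lift]) with those of S^2 and S^3 ([sym2_lift],
    [sym3_lift]). In gr U(M) the supercommutator and the associator of generators come from elements
    of filtration 1, so they vanish ([gr_genC], [gr_genA]), and universality gives a homomorphism
    rho from V(M) to gr U(M). Composed with the canonical map pi from T(M) to V(M) it is the class
    map ([comparison]), whence rho is onto.

    For injectivity, [deformation_exists] gives a bilinear c, of low degree, such that v w + c(v, w)
    is a unital product on V(M) whose generators satisfy the defining relations of U(M). The induced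
    linear map Phi from T(M) to V(M) kills the ideal ([deformed_map]) and differs from pi only by
    terms of lower degree ([leading_term]). If x of degree n > 0 has class zero in gr U(M), it is
    congruent modulo the ideal to some t of filtration n - 1. Then Phi x = Phi t has degree below n,
    and so has Phi x - pi x; as pi x is homogeneous of degree n, it vanishes ([rho_component_inj]).

    The characteristic enters through the half of the bracket in c and through the division by 6 in
    [symmetric_decomposition], where the Akivis identity is exactly the obstruction that has to
    vanish. *)

Lemma linear_factor (K : fieldType) (V W X : lmodType K) (p : V -> W) (h : V -> X) :
  linear p -> linear h -> (forall w, exists v, p v = w) ->
  (forall v, p v = 0 -> h v = 0) ->
  exists g : W -> X, linear g /\ forall v, g (p v) = h v.
Proof.
move=> lp lh sp ker; pose r w := projT1 (cid (sp w)).
have rK w : p (r w) = w by rewrite /r; case: cid.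
have hr u v : p u = p v -> h u = h v.
  move=> e; apply/eqP; rewrite -subr_eq0 -(linB lh); apply/eqP/ker.
  by rewrite (linB lp) e subrr.
exists (h \o r); split=> [a u v|v] /=; last by apply: hr; rewrite rK.
by rewrite -lh; apply: hr; rewrite lp !rK.
Qed.

Section Equalizer.
Variables (K : fieldType) (V W : lmodType K) (f g : V -> W).
Hypotheses (lf : linear f) (lg : linear g).
Fact equalizer0 : f 0 = g 0. Proof. by rewrite (lin0 lf) (lin0 lg). Qed.
Fact equalizerL a u v : f u = g u -> f v = g v -> f (a *: u + v) = g (a *: u + v).
Proof. by rewrite lf lg => -> ->. Qed.
Definition equalizer : subspace V :=
  @Subspace K V (fun v => f v = g v) equalizer0 equalizerL.
End Equalizer.

Section UnitalProducts.
Variables (K : fieldType) (W : nat -> superspace K).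
Variable e0 : W 0%N = scalar_superspace K.

Definition graded_unit : dsum_superspace W := sinj (scast (esym e0) (1 : K^o)).

Lemma scalar_of_inj (a : W 0%N) : scalar_of e0 a = 0 -> a = 0.
Proof.
by rewrite /scalar_of => a0; rewrite -(scastK e0 a) a0 (lin0 (scast_linear _)).
Qed.

Lemma sinj0E (a : W 0%N) : sinj a = scalar_of e0 a *: graded_unit.
Proof.
rewrite -(linZ (@sinj_linear _ W 0)) -(linZ (scast_linear _)) -{1}(scastK e0 a).
by congr (sinj (scast _ _)); rewrite /scalar_of /GRing.scale /= mulr1.
Qed.

Lemma graded_unit_parity : parity (dsum_superspace W) false graded_unit.
Proof. exact/sinj_parity/scast_parity. Qed.

Variable mul : forall i j, W i.+1 -> W j.+1 -> W (i + j).+2.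
Hypothesis mul_bilinear : forall i j, bilinear_map (@mul i j).
Hypothesis mul_parity : forall i j a b x y,
  parity (W i.+1) a x -> parity (W j.+1) b y -> parity _ (a (+) b) (@mul i j x y).
Local Notation A := (gsum (unital_component_product e0 mul_bilinear mul_parity)).

Lemma graded_unitl (v : A) : smul (graded_unit : A) v = v.
Proof.
move: v; apply: dsum_ext; first exact: (smul_bilinear A).2.
  by [].
move=> j y; rewrite [smul _ _]gsum_mul_sinj.
by rewrite /= /scalar_of scastVK scale1r.
Qed.

Lemma graded_unitr (v : A) : smul v (graded_unit : A) = v.
Proof.
move: v; apply: dsum_ext; first exact: (smul_bilinear A).1.
  by [].
move=> [|j] y; rewrite [smul _ _]gsum_mul_sinj /= /scalar_of.
  rewrite -{2}(scastK e0 y) -(linZ (scast_linear _)); congr (sinj (scast _ _)).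
  by rewrite /GRing.scale /= mulr1.
by rewrite scastVK scale1r.
Qed.

End UnitalProducts.

Section TowerTheory.
Variables (K : fieldType) (N : nat) (B : nat -> superspace K).
Variable bm : forall i j, ((i + j).+1 < N)%N -> B i.+1 -> B j.+1 -> B (i + j).+2.
Hypothesis bm_bilinear : forall i j le, bilinear_map (@bm i j le).
Hypothesis bm_parity : forall i j le a b x y,
  parity (B i.+1) a x -> parity (B j.+1) b y -> parity _ (a (+) b) (@bm i j le x y).

Local Notation W := (tower N B).
Local Notation A := (tower_algebra bm_bilinear bm_parity).

Lemma tower_mul_base i j (le : ((i + j).+1 < N)%N) lei lej (x : B i.+1) (y : B j.+1) :
  tower_mul bm (scast (esym (tower_base B lei)) x) (scast (esym (tower_base B lej)) y)
  = scast (esym (tower_base B le)) (bm le x y).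
Proof.
(* The casts depend on proofs of the degree bounds, and those chosen by [tower_mul] come from [idP];
   proof irrelevance identifies them with the given ones. *)
rewrite /tower_mul; case: {-}_ / idP => [le'|//].
rewrite (Prop_irrelevance le' le) (Prop_irrelevance lei (base_lt1 le)).
by rewrite (Prop_irrelevance lej (base_lt2 le)) !scastVK.
Qed.

(** Above degree [N] a component is a direct sum of tensor products of smaller components, so it is
    spanned by pure tensors, and these are values of [tower_mul]. *)
Lemma tower_ind (P : forall n, subspace (W n)) :
  (forall a, P 0%N a) ->
  (forall k (le : (k < N)%N) b, P k.+1 (scast (esym (tower_base B le)) b)) ->
  (forall i j x y, P i.+1 x -> P j.+1 y -> P (i + j).+2 (tower_mul bm x y)) ->
  forall n x, P n x.
Proof.
move=> P0 Pb PM n; elim/ltn_ind: n => -[|k] IH x //.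
case: (@idP (k < N)%N) => [le|nle]; first by rewrite -(scastK (tower_base B le) x).
rewrite -(scastK (tower_rec B nle) x); move: (scast _ x) => {x}.
set Q := preimage_subspace (scast_linear (esym (tower_rec B nle))) (P k.+1).
apply: (dsum_ind (P := Q)) => p; set V := fun p : splitting k.+1 => _.
suff key (x : W (val p).1) (y : W (val p).2) : Q (dinj (V := V) (i := p) (tens x y)).
  exact: (tensor_ind (P := preimage_subspace (@dinj_linear _ _ V p) Q) key).
have Px := IH _ (splitting_lt1 p) x; have Py := IH _ (splitting_lt2 p) y.
case: p x y Px Py => -[i j] H; case/and3P: (H) => /=.
case: i j H => [|i] [|j] // H _ _ e x y Px Py.
(* Substituting this value of [k] makes the ambient component literally the codomain of [tower_mul]
   on degrees [i.+1] and [j.+1]. *)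
have {}e : k = (i + j).+1 by case/eqP: e => <-; rewrite addnS.
move: nle @Q H @V x y Px Py; rewrite {}e => nle Q H V x y Px Py.
suff <- : tower_mul bm x y = scast (esym (tower_rec B nle))
    (dinj (V := V) (i := exist _ (i.+1, j.+1) H) (tens x y)) by apply: PM.
rewrite /tower_mul; case: {-}_ / idP => [//|nle'].
by rewrite (Prop_irrelevance nle' nle) (Prop_irrelevance H (split_pair_subproof i j)).
Qed.

Lemma tower_algebra_ind (P : subspace A) :
  P (graded_unit (tower0 N B)) ->
  (forall k (le : (k < N)%N) b, P (sinj (scast (esym (tower_base B le)) b))) ->
  (forall x y, P x -> P y -> P (smul x y)) -> forall x, P x.
Proof.
move=> P1 Pb PM; apply: dsum_ind => n x; rewrite -/(sinj (W := W) x).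
pose Q n : subspace (W n) := preimage_subspace (@sinj_linear _ W n) P.
apply: (tower_ind (P := Q)) => [a|k le b|i j u v Pu Pv] /=; last 2 first.
- exact: Pb.
- by have := PM _ _ Pu Pv; rewrite [smul _ _]gsum_mul_sinj.
by rewrite (sinj0E (tower0 N B)); apply: subspaceZ.
Qed.

Section Recursion.
Variables (X : lmodType K) (m : X -> X -> X) (u : X) (phi : forall n, B n -> X).
Hypotheses (bilm : bilinear_map m) (lphi : forall n, linear (@phi n)).

(** [dlift] and [tlift] accept arbitrary families of functions, so the recursion carries no
    linearity proofs; linearity is recovered afterwards in [tower_fold_linear]. *)
Definition tower_fold_step n : (forall k, (k < n)%N -> W k -> X) -> W n -> X :=
  match n return (forall k, (k < n)%N -> W k -> X) -> W n -> X with
  | 0%N => fun _ a => scalar_of (tower0 N B) a *: u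
  | k.+1 => fun rec x =>
    match @idP (k < N)%N with
    | ReflectT le => phi (scast (tower_base B le) x)
    | ReflectF nle =>
      dlift (V := fun p : splitting k.+1 =>
               tensor_superspace (W (val p).1) (W (val p).2) : lmodType K)
        (fun p => tlift (fun a b =>
           m (rec _ (splitting_lt1 p) a) (rec _ (splitting_lt2 p) b)))
        (scast (tower_rec B nle) x)
    end
  end.

Definition tower_fold n : W n -> X :=
  Fix ltn_well_founded (fun n => W n -> X) tower_fold_step n.

Lemma tower_foldE n :
  @tower_fold n = tower_fold_step (fun k (_ : (k < n)%N) => @tower_fold k).
Proof.
apply: (Fix_eq ltn_well_founded (fun n => W n -> X)) => k f g fg.
congr tower_fold_step; apply: functional_extensionality_dep => l.
by apply: functional_extensionality_dep => lk; apply: fg.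
Qed.

Lemma tower_fold0 (a : W 0%N) : tower_fold a = scalar_of (tower0 N B) a *: u.
Proof. by rewrite tower_foldE. Qed.

Let fold_bilinear i j (f : W i -> X) (g : W j -> X) : linear f -> linear g ->
  bilinear_map (fun a b => m (f a) (g b)).
Proof. by move=> lf lg; split=> [w|v] a x y; rewrite ?lf ?lg ?bilm.1 ?bilm.2. Qed.

Lemma tower_fold_linear n : linear (@tower_fold n).
Proof.
elim/ltn_ind: n => -[|k] IH a x y; rewrite tower_foldE /=.
  exact: scalar_of_linear.
case: {-}_ / idP => [le|nle]; rewrite scast_linear; first exact: lphi.
apply: dlift_linear => p; apply: tlift_linear.
by apply: fold_bilinear; apply: IH; [exact: splitting_lt1 | exact: splitting_lt2].
Qed.

Lemma tower_fold_base k (le : (k < N)%N) (b : B k.+1) :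
  tower_fold (scast (esym (tower_base B le)) b) = phi b.
Proof.
rewrite tower_foldE /=; case: {-}_ / idP => [le'|//].
by rewrite (Prop_irrelevance le' le) scastVK.
Qed.

Hypothesis phiM : forall i j le (x : B i.+1) (y : B j.+1),
  phi (@bm i j le x y) = m (phi x) (phi y).

Lemma tower_foldM i j (x : W i.+1) (y : W j.+1) :
  tower_fold (tower_mul bm x y) = m (tower_fold x) (tower_fold y).
Proof.
have [le|nle] := @idP ((i + j).+1 < N)%N.
  rewrite -(scastK (tower_base B (base_lt1 le)) x) -(scastK (tower_base B (base_lt2 le)) y).
  by rewrite tower_mul_base !tower_fold_base.
rewrite tower_foldE /= /tower_mul; case: {-}_ / idP => [//|nle'].
rewrite scastVK.
have bl (p : splitting (i + j).+2) := fold_bilinear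
  (@tower_fold_linear (val p).1) (@tower_fold_linear (val p).2).
rewrite (dlift_dinj (V := fun p : splitting (i + j).+2 =>
  tensor_superspace (W (val p).1) (W (val p).2) : lmodType K)).
  by rewrite (tlift_tens (bl (split_pair i j))).
by move=> p; apply: tlift_linear.
Qed.

Hypotheses (mul1 : forall v, m u v = v) (mulr1 : forall v, m v u = v).

(** The universal property of a tower: a linear map on the base that respects the base products
    extends to a unital homomorphism into any unital algebra, since beyond degree [N] the product is
    free. No associativity of [m] is involved. *)
Lemma tower_lift : exists F : A -> X,
  [/\ linear F, F (graded_unit (tower0 N B)) = u,
      forall k (le : (k < N)%N) b, F (sinj (scast (esym (tower_base B le)) b)) = phi b
    & forall x y, F (smul x y) = m (F x) (F y)].
Proof.
pose F : A -> X := dlift (V := fun i => W i : lmodType K) tower_fold.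
have lF : linear F by apply: dlift_linear; apply: tower_fold_linear.
have FE n x : F (sinj (x : W n)) = tower_fold x.
  exact: (dlift_dinj (V := fun i => W i : lmodType K) tower_fold_linear).
have [ml mr] := smul_bilinear A.
exists F; split=> [||k le b|x] //.
- by rewrite FE tower_fold0 /scalar_of scastVK scale1r.
- by rewrite FE tower_fold_base.
apply: dsum_ext; first exact: linear_comp.
- exact: (linear_comp (bilm.2 _)).
move=> j y; move: x; apply: dsum_ext; first exact: (linear_comp lF (ml _)).
  exact: (linear_comp (bilm.1 _)).
move=> i x; rewrite -!/(sinj _) [smul _ _]gsum_mul_sinj !FE.
case: i j x y => [|i] [|j] x y /=; rewrite FE ?(linZ (@tower_fold_linear _)).
- by rewrite [X in m X _]tower_fold0 (linZ (bilm.1 _)) mul1.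
- by rewrite [X in m X _]tower_fold0 (linZ (bilm.1 _)) mul1.
- by rewrite [X in m _ X]tower_fold0 (linZ (bilm.2 _)) mulr1.
exact: tower_foldM.
Qed.

End Recursion.
End TowerTheory.

(** * Symmetric squares and cubes *)

Definition supersymmetric (K : fieldType) (M : superspace K) (X : lmodType K)
    (h : M -> M -> X) :=
  forall a b x y, parity M a x -> parity M b y -> h x y = (-1) ^+ (a && b) *: h y x.

Definition trilinear_map (K : fieldType) (M X : lmodType K) (h : M -> M -> M -> X) :=
  (forall z, bilinear_map (fun x y => h x y z)) /\ (forall x, bilinear_map (h x)).

Section SymmetricPowers.
Variables (K : fieldType) (M : superspace K).
Local Notation T := (tensor_algebra M).
Local Notation TP := (tensor_power M).
Local Notation SP := (sym_power M).

Lemma tens_scale (V : lmodType K) (v : V) (c : K^o) : tens v c = c *: tens v (1 : K^o).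
Proof. by rewrite -(linZ ((tens_bilinear _ _).2 v)) /GRing.scale /= mulr1. Qed.

Lemma tcat_tens n j m (w : TP n) (y : TP j) :
  @tcat K M n.+1 j (tens m w) y = tens m (tcat w y).
Proof.
have [bl br] := tens_bilinear M (TP (n + j)).
have [cl _] := @tcat_bilinear K M n j.
by rewrite /= tlift_tens //; split=> [t a u v|v a t t']; rewrite ?bl ?cl ?br.
Qed.

Section Kernel.
Variables (Q2 : subspace (TP 2)) (Q3 : subspace (TP 3)).
Hypothesis Q2_sym : forall a b x y, parity M a x -> parity M b y ->
  Q2 (tens x (tens y (1 : K^o)) - (-1) ^+ (a && b) *: tens y (tens x (1 : K^o))).
Hypothesis Q3_left : forall m t, Q2 t -> Q3 (tens m t).
Hypothesis Q3_right : forall t m, Q2 t -> Q3 (@tcat K M 2 1 t (tens m (1 : K^o))).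

(** A candidate graded ideal, truncated: since everything is allowed from degree 4 on, its stability
    under products is a condition in degrees at most 3 only. *)
Let Q n : subspace (TP n) :=
  match n return subspace (TP n) with
  | 0%N => zero_subspace (TP 0) | 1%N => zero_subspace (TP 1) | 2%N => Q2 | 3%N => Q3
  | n.+4 => full_subspace (TP n.+4)
  end.

Let Q_big n w : (4 <= n)%N -> Q n w.
Proof. by case: n w => [|[|[|[|n]]]]. Qed.

Let tcat0 i j (y : TP j) : @tcat K M i j 0 y = 0.
Proof. exact: (lin0 ((@tcat_bilinear K M i j).1 y)). Qed.
Let tcatr0 i j (x : TP i) : @tcat K M i j x 0 = 0.
Proof. exact: (lin0 ((@tcat_bilinear K M i j).2 x)). Qed.

(** For literal degrees [n + 0] reduces to [n], so this identity and the next two typecheck without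
    a cast. *)
Let tcat_scalar1 : forall (c : K^o) (t : TP 1), @tcat K M 1 0 t c = c *: t.
Proof.
move=> c; apply: tensor_ext.
- exact: ((@tcat_bilinear K M 1 0).1 c).
- by move=> a x y; rewrite scalerDr !scalerA mulrC.
move=> m w; rewrite (tcat_tens m (w : TP 0) (c : TP 0)) -(linZ ((tens_bilinear _ _).2 m)).
by congr tens; rewrite /= /GRing.scale /= mulrC.
Qed.

Let tcat_scalar2 : forall (c : K^o) (t : TP 2), @tcat K M 2 0 t c = c *: t.
Proof.
move=> c; apply: tensor_ext.
- exact: ((@tcat_bilinear K M 2 0).1 c).
- by move=> a x y; rewrite scalerDr !scalerA mulrC.
by move=> m w; rewrite (tcat_tens m (w : TP 1) (c : TP 0)) tcat_scalar1
  (linZ ((tens_bilinear _ _).2 m)).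
Qed.

Let tcat_scalar3 : forall (c : K^o) (t : TP 3), @tcat K M 3 0 t c = c *: t.
Proof.
move=> c; apply: tensor_ext.
- exact: ((@tcat_bilinear K M 3 0).1 c).
- by move=> a x y; rewrite scalerDr !scalerA mulrC.
by move=> m w; rewrite (tcat_tens m (w : TP 2) (c : TP 0)) tcat_scalar2
  (linZ ((tens_bilinear _ _).2 m)).
Qed.

Let Q3_left' (w : TP 1) (t : TP 2) : Q2 t -> Q3 (@tcat K M 1 2 w t).
Proof.
move=> Qt; move: w.
apply: (tensor_ind (P := preimage_subspace ((@tcat_bilinear K M 1 2).1 t) Q3)) => m c.
change (Q3 (@tcat K M 1 2 (tens m c) t)).
by rewrite (tcat_tens m (c : TP 0) t); apply/Q3_left/subspaceZ.
Qed.

Let Q3_right' (w : TP 1) (t : TP 2) : Q2 t -> Q3 (@tcat K M 2 1 t w).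
Proof.
move=> Qt; move: w.
apply: (tensor_ind (P := preimage_subspace ((@tcat_bilinear K M 2 1).2 t) Q3)) => m c.
change (Q3 (@tcat K M 2 1 t (tens m c))).
rewrite tens_scale (linZ ((@tcat_bilinear K M 2 1).2 t)).
exact/subspaceZ/Q3_right.
Qed.

Let Q_mulr i j (x : TP i) (y : TP j) : Q i x -> Q (i + j) (@tcat K M i j x y).
Proof.
case: i x => [|[|[|[|i]]]] x Qx.
- by rewrite Qx tcat0; apply: subspace0.
- by rewrite Qx tcat0; apply: subspace0.
- case: j y => [|[|j]] y; last exact: Q_big.
  + by rewrite tcat_scalar2; apply: subspaceZ.
  + exact: Q3_right'.
- case: j y => [|j] y; last exact: Q_big.
  by rewrite tcat_scalar3; apply: subspaceZ.
exact: Q_big.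
Qed.

Let Q_mull i j (x : TP i) (y : TP j) : Q j y -> Q (i + j) (@tcat K M i j x y).
Proof.
case: i x => [|[|i]] x.
- exact: subspaceZ.
- case: j y => [|[|[|j]]] y Qy; last exact: Q_big.
  + by rewrite Qy tcatr0; apply: subspace0.
  + by rewrite Qy tcatr0; apply: subspace0.
  + exact: Q3_left'.
case: j y => [|[|j]] y Qy.
- by rewrite Qy tcatr0; apply: subspace0.
- by rewrite Qy tcatr0; apply: subspace0.
by apply: Q_big; rewrite !addSn !addnS.
Qed.

(* The elements of degree at least 2 with components in Q2 and Q3 in degrees 2   *)
(* and 3 form an ideal of T(M) containing the supersymmetry relations.           *)
Lemma sym_class_kernel (u : T) : sym_class u = 0 ->
  Q2 (dcoef (V := fun i => TP i : lmodType K) 2%N u) /\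
  Q3 (dcoef (V := fun i => TP i : lmodType K) 3%N u).
Proof.
pose in_ker (f : T) := forall n, Q n (dcoef (V := fun i => TP i : lmodType K) n f).
have in_ker0 : in_ker 0 by move=> n; apply: subspace0.
have in_kerL a f g : in_ker f -> in_ker g -> in_ker (a *: f + g).
  by move=> Qf Qg n; rewrite dcoef_linear; apply: subspaceL.
have in_ker_inj n (w : TP n) : Q n w -> in_ker (sinj w).
  move=> Qw k; have [<-|ne] := eqVneq n k; first by rewrite /sinj dcoef_dinj.
  by rewrite /sinj dcoef_dinj0 //; apply: subspace0.
move/qpi0 => /(_ (Subspace in_ker0 in_kerL)) H.
suff Ku : in_ker u by split; [exact: (Ku 2%N) | exact: (Ku 3%N)].
apply: H => [f g Qf|_ [a b x y px py]] /=.
  split; apply: (@subspace_sum _ _ (Subspace in_ker0 in_kerL)) => i;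
    apply: (@subspace_sum _ _ (Subspace in_ker0 in_kerL)) => j; apply: in_ker_inj.
    exact: Q_mulr.
  exact: Q_mull.
rewrite !gsum_mul_sinj /cprod /tensor_prod -(linZ (@sinj_linear _ TP 2)).
rewrite -(linB (@sinj_linear _ TP 2)); apply: in_ker_inj.
by rewrite !(tcat_tens _ (1 : TP 0)) /= !scale1r; apply: Q2_sym.
Qed.

End Kernel.

(** The shift by two is due to S^0 and S^1 being K and M themselves rather than images in the
    quotient. *)
Definition sym_proj n (t : TP n.+2) : SP n.+2 :=
  insubspace (ex_intro2 _ _ (sinj t) (ex_intro2 _ _ t I erefl) erefl
    : sym_image M n.+2 (sym_class (sinj t))).

Lemma sym_proj_linear n : linear (@sym_proj n).
Proof.
move=> a t u; apply: val_inj; rewrite [RHS](@subspace_val_linear _ _ (sym_image M n.+2)).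
by rewrite !val_insubspace -sym_class_linear -sinj_linear.
Qed.

Lemma sym_proj_surj n (s : SP n.+2) : exists t, sym_proj t = s.
Proof.
have [_ [t _ ->] e] := @subspace_valP _ _ (sym_image M n.+2) s.
by exists t; apply: val_inj.
Qed.

Lemma sym_proj_eq0 n (t : TP n.+2) : sym_proj t = 0 -> sym_class (sinj t) = 0.
Proof. by move/(congr1 val). Qed.

Definition sym_mul2 (x y : M) : SP 2 := @sym_mul K M 0 0 x y.
Definition sym_mul3 (x : M) (s : SP 2) : SP 3 := @sym_mul K M 0 1 x s.

Lemma sym_mul2E x y : sym_mul2 x y = @sym_proj 0 (tens x (tens y (1 : K^o))).
Proof.
apply: val_inj; transitivity (sym_class (smul (tensor_gen x) (tensor_gen y))).
  by rewrite sym_classM.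
rewrite /tensor_gen [smul _ _]gsum_mul_sinj.
by rewrite /cprod /= /tensor_prod (tcat_tens _ (1 : TP 0)) /= scale1r.
Qed.

Lemma sym_mul3E x t : sym_mul3 x (@sym_proj 0 t) = @sym_proj 1 (tens x t).
Proof.
apply: val_inj; transitivity (sym_class (smul (tensor_gen x) (sinj t : T))).
  by rewrite sym_classM.
rewrite /tensor_gen [smul _ _]gsum_mul_sinj.
by rewrite /cprod /= /tensor_prod (tcat_tens _ (1 : TP 0)) /= scale1r.
Qed.

Lemma sym_mul3rE t x :
  @sym_mul K M 1 0 (@sym_proj 0 t) x = @sym_proj 1 (@tcat K M 2 1 t (tens x (1 : K^o))).
Proof.
apply: val_inj; transitivity (sym_class (smul (sinj t : T) (tensor_gen x))).
  by rewrite sym_classM.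
by rewrite /tensor_gen [smul _ _]gsum_mul_sinj.
Qed.

Lemma sym_mul2A x y z : @sym_mul K M 1 0 (sym_mul2 x y) z = sym_mul3 x (sym_mul2 y z).
Proof.
rewrite !sym_mul2E sym_mul3rE sym_mul3E (@tcat_tens 1 1 x (tens y (1 : K^o)) (tens z (1 : K^o))).
by rewrite (@tcat_tens 0 1 y (1 : K^o) (tens z (1 : K^o))) /= scale1r.
Qed.

Lemma sym_mul2_bilinear : bilinear_map sym_mul2.
Proof. exact: (@sym_mul_bilinear K M 0 0). Qed.

Lemma sym_mul3_bilinear : bilinear_map sym_mul3.
Proof. exact: (@sym_mul_bilinear K M 0 1). Qed.

Lemma sym_mul2C : supersymmetric sym_mul2.
Proof.
move=> a b x y px py; apply: val_inj.
rewrite [RHS](linZ (@subspace_val_linear _ _ (sym_image M 2))).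
transitivity (sym_class (smul (tensor_gen x) (tensor_gen y))); first by rewrite sym_classM.
transitivity ((-1) ^+ (a && b) *: sym_class (smul (tensor_gen y) (tensor_gen x)));
  last by rewrite sym_classM.
rewrite -(linZ (@sym_class_linear K M)); apply/qpi_eq/mem_ideal_gen.
exact: SuperSymRel.
Qed.

Lemma sym2_ind (P : subspace (SP 2)) : (forall x y, P (sym_mul2 x y)) -> forall s, P s.
Proof.
move=> PM s; have [t <-] := sym_proj_surj s; move: t.
apply: (tensor_ind (P := preimage_subspace (@sym_proj_linear 0) P)) => x.
apply: (tensor_ind (P := preimage_subspace ((tens_bilinear M (TP 1)).2 x)
  (preimage_subspace (@sym_proj_linear 0) P))) => y c /=.
rewrite tens_scale (linZ ((tens_bilinear M (TP 1)).2 x)) (linZ (@sym_proj_linear 0)).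
by rewrite -sym_mul2E; apply: subspaceZ.
Qed.

Lemma sym3_ind (P : subspace (SP 3)) :
  (forall x y z, P (sym_mul3 x (sym_mul2 y z))) -> forall s, P s.
Proof.
move=> PM s; have [t <-] := sym_proj_surj s; move: t.
apply: (tensor_ind (P := preimage_subspace (@sym_proj_linear 1) P)) => x t /=.
rewrite -sym_mul3E.
exact: (sym2_ind (P := preimage_subspace (sym_mul3_bilinear.2 x) P) (PM x)).
Qed.

Section Lifts.
Variable X : lmodType K.

(** The second tensor power is encoded as M (x) (M (x) K), hence the additional scalar argument. *)
Definition tensor2_lift (h : M -> M -> X) : TP 2 -> X :=
  tlift (fun x => tlift (fun y (c : K^o) => (c : K) *: h x y)).

Lemma tensor2_lift_bilinear (h : M -> M -> X) : bilinear_map h ->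
  (forall x, bilinear_map (fun y (c : K^o) => (c : K) *: h x y)) /\
  bilinear_map (fun x => tlift (fun y (c : K^o) => (c : K) *: h x y)).
Proof.
move=> bh.
have b1 x : bilinear_map (fun y (c : K^o) => (c : K) *: h x y).
  split=> [c a y y'|y a c c']; first by rewrite bh.2 scalerDr !scalerA mulrC.
  by rewrite scalerDl scalerA.
split=> //; split=> [w a x x'|x]; last exact: tlift_linear.
move: w; apply: tensor_ext; first exact: tlift_linear.
  move=> c u v; rewrite !(tlift_linear (b1 _)) !scalerDr addrACA; congr (_ + _).
  by rewrite !scalerA mulrC.
move=> y c; rewrite !(tlift_tens (b1 _)) bh.1 scalerDr !scalerA; congr (_ + _).
by rewrite mulrC.
Qed.

Lemma tensor2_lift_linear h : bilinear_map h -> linear (tensor2_lift h).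
Proof. by case/tensor2_lift_bilinear => _ /tlift_linear. Qed.

Lemma tensor2_liftE h x y : bilinear_map h ->
  tensor2_lift h (tens x (tens y (1 : K^o))) = h x y.
Proof.
case/tensor2_lift_bilinear => b1 b2.
by rewrite /tensor2_lift (tlift_tens b2) (tlift_tens (b1 x)) scale1r.
Qed.

(** The lift of [h] to the tensor square must vanish on the kernel of the projection to S^2. Take
    its kernel as [Q2] in [sym_class_kernel], with no constraint in degree 3. *)
Lemma sym2_lift (h : M -> M -> X) : bilinear_map h -> supersymmetric h ->
  exists g : SP 2 -> X, linear g /\ forall x y, g (sym_mul2 x y) = h x y.
Proof.
move=> bh sh; have lh := tensor2_lift_linear bh.
have [|g [lg gE]] := linear_factor (@sym_proj_linear 0) lh (@sym_proj_surj 0).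
  move=> t /sym_proj_eq0 e.
  have [||||+ _] := @sym_class_kernel (preimage_subspace lh (zero_subspace X))
    (full_subspace _) _ _ _ (sinj t) => //.
    move=> a b x y px py /=; rewrite (linB lh) (linZ lh) !tensor2_liftE //.
    by rewrite (sh a b) ?subrr.
  by rewrite /= /sinj dcoef_dinj.
by exists g; split=> // x y; rewrite sym_mul2E gE tensor2_liftE.
Qed.

Lemma sym3_lift (h : M -> M -> M -> X) : trilinear_map h ->
  (forall z, supersymmetric (fun x y => h x y z)) ->
  (forall x, supersymmetric (h x)) ->
  exists g : SP 3 -> X, linear g /\ forall x y z, g (sym_mul3 x (sym_mul2 y z)) = h x y z.
Proof.
move=> [bh1 bh2] s12 s23; pose H : TP 3 -> X := tlift (fun x => tensor2_lift (h x)).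
have bH : bilinear_map (fun x => tensor2_lift (h x)).
  split=> [t a x x'|x]; last exact: tensor2_lift_linear.
  move: t; apply: tensor_ext; first exact: tensor2_lift_linear.
    move=> c u v; rewrite !(tensor2_lift_linear (bh2 _)) !scalerDr addrACA.
    by rewrite !scalerA mulrC.
  move=> y; apply: tensor_ext.
  - apply: (linear_comp (tensor2_lift_linear (bh2 _))).
    exact: (tens_bilinear _ _).2.
  - move=> c u v; rewrite !((tens_bilinear M (TP 1)).2 y).
    rewrite !(tensor2_lift_linear (bh2 _)) !scalerDr addrACA.
    by rewrite !scalerA mulrC.
  move=> z c; rewrite tens_scale !(linZ ((tens_bilinear M (TP 1)).2 y)).
  rewrite !(linZ (tensor2_lift_linear (bh2 _))) !tensor2_liftE //.
  by rewrite ((bh1 z).1 y) scalerDr !scalerA mulrC.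
have lH : linear H by apply: tlift_linear.
have HE x y z : H (tens x (tens y (tens z (1 : K^o)))) = h x y z.
  by rewrite /H (tlift_tens bH) tensor2_liftE.
have [|g [lg gE]] := linear_factor (@sym_proj_linear 1) lH (@sym_proj_surj 1).
  (* The largest choice of [Q2] whose products with M on both sides lie in the kernel of [H], which
     serves as [Q3]. It contains the relations by symmetry of [h] in each pair of adjacent
     arguments. *)
  pose Q2 t := (forall m, H (tens m t) = 0) /\
               (forall m, H (@tcat K M 2 1 t (tens m (1 : K^o))) = 0).
  have br m := (tens_bilinear M (TP 2)).2 m.
  have bl m := (@tcat_bilinear K M 2 1).1 (tens m (1 : K^o)).
  have Q20 : Q2 0.
    by split=> m; rewrite ?(lin0 (br _)) ?(lin0 (bl _)) (lin0 lH).
  have Q2L a u v : Q2 u -> Q2 v -> Q2 (a *: u + v).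
    move=> [u1 u2] [v1 v2]; split=> m; rewrite ?(br m) ?(bl m) lH.
      by rewrite u1 v1 scaler0 addr0.
    by rewrite u2 v2 scaler0 addr0.
  move=> t /sym_proj_eq0 e.
  have [||||_ ] := @sym_class_kernel (Subspace Q20 Q2L)
    (preimage_subspace lH (zero_subspace X)) _ _ _ (sinj t) => //.
  - move=> a b x y px py /=; split=> m.
      rewrite (linB (br _)) (linZ (br _)) (linB lH) (linZ lH) !HE.
      by rewrite (s23 _ a b) ?subrr.
    rewrite (linB (bl _)) (linZ (bl _)).
    rewrite (@tcat_tens 1 1 x (tens y (1 : K^o)) (tens m (1 : K^o))).
    rewrite (@tcat_tens 1 1 y (tens x (1 : K^o)) (tens m (1 : K^o))).
    rewrite (@tcat_tens 0 1 x (1 : K^o) (tens m (1 : K^o))).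
    rewrite (@tcat_tens 0 1 y (1 : K^o) (tens m (1 : K^o))) /= !scale1r.
    by rewrite (linB lH) (linZ lH) !HE (s12 _ a b) ?subrr.
  - by move=> m u [Hu _]; apply: Hu.
  - by move=> u m [_ Hu]; apply: Hu.
  by rewrite /= /sinj dcoef_dinj.
by exists g; split=> // x y z; rewrite sym_mul2E sym_mul3E gE HE.
Qed.

End Lifts.
End SymmetricPowers.

(** * Universal properties of the free algebra and of V(M) *)

Section FreeAlgebra.
Variables (K : fieldType) (M : superspace K).
Local Notation T := (nonassociative_tensor_algebra M).

Definition tunit : T := graded_unit (tower0 1 (fun=> M)).

Lemma free_component_ind (P : forall n, subspace (tower 1 (fun=> M) n)) :
  (forall a, P 0%N a) ->
  (forall x, P 1%N (scast (esym (@tower_base K 1 (fun=> M) 0 isT)) x)) ->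
  (forall i j x y, P i.+1 x -> P j.+1 y ->
     P (i + j).+2 (tower_mul (@no_mul K M) x y)) ->
  forall n x, P n x.
Proof.
move=> P0 P1 PM; apply: (tower_ind (bm := @no_mul K M)) => // -[|k] le b //.
by rewrite (Prop_irrelevance le isT).
Qed.

(** The free algebra is the tower with [N = 1]: no product of positive degrees lands in the base, so
    compatibility with base products is vacuous in [tower_lift]. *)
Lemma free_algebra_lift (X : lmodType K) (m : X -> X -> X) (u : X) (phi : M -> X) :
  bilinear_map m -> (forall v, m u v = v) -> (forall v, m v u = v) -> linear phi ->
  exists F : T -> X, [/\ linear F, F tunit = u, forall x, F (tgen x) = phi x
    & forall x y, F (smul x y) = m (F x) (F y)].
Proof.
move=> bm m1 mr1 lphi.
have [//|F [lF F1 Fb FM]] := tower_lift (@no_mul_bilinear K M) (@no_mul_parity K M)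
  (phi := fun _ : nat => phi) bm (fun=> lphi) _ m1 mr1.
by exists F; split=> // x; rewrite /tgen Fb.
Qed.

End FreeAlgebra.

Section VAlgebra.
Variables (K : fieldType) (M : superspace K).
Local Notation SP := (sym_power M).
Local Notation V := (V_algebra M).
Local Notation W := (tower 3 SP).

Definition vunit : V := graded_unit (tower0 3 SP).

Definition vbase k (le : (k < 3)%N) (s : SP k.+1) : V :=
  sinj (scast (esym (tower_base SP le)) s).

Definition vgen (x : M) : V := vbase (k := 0) isT x.
Definition vgen2 (s : SP 2) : V := vbase (k := 1) isT s.
Definition vgen3 (s : SP 3) : V := vbase (k := 2) isT s.

Lemma vbase_linear k le : linear (@vbase k le).
Proof. by move=> a s t; rewrite /vbase scast_linear sinj_linear. Qed.

Lemma vbase_irr k (le le' : (k < 3)%N) s : vbase le s = vbase le' s.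
Proof. by rewrite (Prop_irrelevance le le'). Qed.

Lemma vbaseM i j (le : ((i + j).+1 < 3)%N) lei lej (s : SP i.+1) (t : SP j.+1) :
  smul (vbase lei s) (vbase lej t) = vbase le (sym_mul s t).
Proof.
by rewrite [smul _ _]gsum_mul_sinj /= (tower_mul_base _ le).
Qed.

Lemma vgenM x y : smul (vgen x) (vgen y) = vgen2 (sym_mul2 x y).
Proof. exact: vbaseM. Qed.

Lemma vgenM2 x s : smul (vgen x) (vgen2 s) = vgen3 (sym_mul3 x s).
Proof. exact: vbaseM. Qed.

Lemma vgen2M s x : smul (vgen2 s) (vgen x) = vgen3 (@sym_mul K M 1 0 s x).
Proof. exact: vbaseM. Qed.

Lemma vgenC : supersymmetric (fun x y => smul (vgen x) (vgen y)).
Proof.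
move=> a b x y px py; rewrite !vgenM (sym_mul2C px py).
by rewrite /vgen2 (linZ (@vbase_linear 1 isT)).
Qed.

Lemma vgenA x y z : smul (smul (vgen x) (vgen y)) (vgen z)
  = smul (vgen x) (smul (vgen y) (vgen z)).
Proof. by rewrite !vgenM vgenM2 vgen2M sym_mul2A. Qed.

Lemma vgen_parity a x : parity M a x -> parity V a (vgen x).
Proof. by move=> px; apply/sinj_parity/scast_parity. Qed.

Lemma V_algebra_ind (P : subspace V) :
  P vunit -> (forall x, P (vgen x)) ->
  (forall x y, P x -> P y -> P (smul x y)) -> forall x, P x.
Proof.
move=> P1 Pg PM.
have P2 x y : P (vgen2 (sym_mul2 x y)) by rewrite -vgenM; apply: PM.
apply: tower_algebra_ind => // -[|[|[|k]]] le b //; rewrite -/(vbase le b).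
- by rewrite (vbase_irr le isT).
- rewrite (vbase_irr le isT).
  exact: (sym2_ind (P := preimage_subspace (@vbase_linear 1 isT) P) P2).
rewrite (vbase_irr le isT).
apply: (sym3_ind (P := preimage_subspace (@vbase_linear 2 isT) P)) => x y z.
by rewrite /= -/(vgen3 _) -vgenM2; apply: PM.
Qed.

Lemma V_algebra_lift (X : lmodType K) (m : X -> X -> X) (u : X) (phi : M -> X) :
  bilinear_map m -> (forall v, m u v = v) -> (forall v, m v u = v) -> linear phi ->
  supersymmetric (fun x y => m (phi x) (phi y)) ->
  (forall x y z, m (m (phi x) (phi y)) (phi z) = m (phi x) (m (phi y) (phi z))) ->
  exists F : V -> X, [/\ linear F, F vunit = u, forall x, F (vgen x) = phi x
    & forall x y, F (smul x y) = m (F x) (F y)].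
Proof.
move=> [bl br] m1 mr1 lphi sphi aphi.
have bphi : bilinear_map (fun x y => m (phi x) (phi y)).
  by split=> [y|x] a u1 u2; rewrite lphi ?bl ?br.
have [phi2 [lphi2 phi2E]] := sym2_lift bphi sphi.
have [|||phi3 [lphi3 phi3E]] :=
    @sym3_lift K M X (fun x y z => m (phi x) (m (phi y) (phi z))).
- by split=> w; split=> v a u1 u2; rewrite lphi ?bl ?br ?bl ?br.
(* Symmetry in the first two factors is visible only after rebracketing to the left. *)
- move=> z a b x y px py.
  by rewrite -!aphi (sphi a b x y px py) (linZ (bl _)).
- move=> x a b y z py pz.
  by rewrite (sphi a b y z py pz) (linZ (br _)).
(* [tower_lift] wants a map in every degree, but reads it only in degrees 1 to 3; elsewhere 0 is a
   placeholder. *)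
pose f n : SP n -> X := match n return SP n -> X with
  | 1%N => phi | 2%N => phi2 | 3%N => phi3 | _ => fun=> 0 end.
have lf n : linear (f n).
  case: n => [|[|[|[|n]]]] //; rewrite /f => a x y; by rewrite scaler0 addr0.
have fM i j (le : ((i + j).+1 < 3)%N) (x : SP i.+1) (y : SP j.+1) :
    f _ (sym_mul x y) = m (f _ x) (f _ y).
  have [ml mr] := @sym_mul_bilinear K M i j.
  case: i j le x y ml mr => [|[|i]] [|[|j]] le x y ml mr //.
  - exact: phi2E.
  - have b1 := linear_comp lphi3 (mr x); have b2 := linear_comp (br (phi x)) lphi2.
    apply: (sym2_ind (P := equalizer b1 b2)) => y1 y2 /=.
    by rewrite [LHS]phi3E phi2E.
  (* The product of S^2 by S^1: here [phi3], defined through right-bracketed products, is compared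
     with left-bracketed ones by [aphi]. *)
  - have b1 := linear_comp lphi3 (ml y); have b2 := linear_comp (bl (phi y)) lphi2.
    apply: (sym2_ind (P := equalizer b1 b2)) => x1 x2 /=.
    by rewrite sym_mul2A [LHS]phi3E phi2E aphi.
have [F [lF F1 Fb FM]] := tower_lift (N := 3)
  (bm := fun i j _ => @sym_mul K M i j) (fun i j _ => @sym_mul_bilinear K M i j)
  (fun i j _ => @sym_mul_parity K M i j) (conj bl br) lf fM m1 mr1.
by exists F; split=> // x; rewrite /vgen /vbase Fb.
Qed.

End VAlgebra.

(** * Symmetrization of trilinear maps *)

Section LinearExpressions.
Variables (K : fieldType) (X : lmodType K).

(** Reflected linear combinations: an identity in a vector space reduces to equality of
    coefficients, one goal in K per atom, within reach of [ring] and [field]. *)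
Inductive linexp :=
  | LinVar of nat | LinZero | LinAdd of linexp & linexp
  | LinOpp of linexp | LinScale of K & linexp.

Fixpoint lin_eval (env : seq X) (e : linexp) : X :=
  match e with
  | LinVar n => env`_n
  | LinZero => 0
  | LinAdd e1 e2 => lin_eval env e1 + lin_eval env e2
  | LinOpp e1 => - lin_eval env e1
  | LinScale c e1 => c *: lin_eval env e1
  end.

Fixpoint lin_coef (n : nat) (e : linexp) : K :=
  match e with
  | LinVar k => (k == n)%:R
  | LinZero => 0
  | LinAdd e1 e2 => lin_coef n e1 + lin_coef n e2
  | LinOpp e1 => - lin_coef n e1
  | LinScale c e1 => c * lin_coef n e1
  end.

Fixpoint lin_coef_eq (n : nat) (e1 e2 : linexp) : Prop :=
  if n is k.+1 then lin_coef k e1 = lin_coef k e2 /\ lin_coef_eq k e1 e2 else True.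

Lemma lin_evalE env e :
  lin_eval env e = \sum_(i < size env) lin_coef i e *: env`_i.
Proof.
elim: e => [n||e1 IH1 e2 IH2|e IH|c e IH] /=.
- have [lt|ge] := ltnP n (size env).
    rewrite (bigD1 (Ordinal lt)) //= eqxx scale1r big1 ?addr0 // => i ne.
    case: eqP => [e|]; last by rewrite scale0r.
    by case/eqP: ne; apply: val_inj; rewrite /= e.
  rewrite nth_default // big1 // => i _; case: eqP => [e|]; last by rewrite scale0r.
  by have := ltn_ord i; rewrite -e ltnNge ge.
- by rewrite big1 // => i _; rewrite scale0r.
- by rewrite IH1 IH2 -big_split; apply: eq_bigr => i _; rewrite scalerDl.
- by rewrite IH -sumrN; apply: eq_bigr => i _; rewrite scaleNr.
by rewrite IH scaler_sumr; apply: eq_bigr => i _; rewrite scalerA.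
Qed.

Lemma lin_eval_eq env e1 e2 :
  lin_coef_eq (size env) e1 e2 -> lin_eval env e1 = lin_eval env e2.
Proof.
move=> H; rewrite !lin_evalE; apply: eq_bigr => i _; congr (_ *: _).
move: H (ltn_ord i); move: (nat_of_ord i) => k; elim: (size env) => // n IH [e H].
by rewrite ltnS leq_eqVlt => /orP[/eqP ->|/(IH H)].
Qed.

(** To derive an identity from a known linear relation, it suffices to name the multiple [c] of that
    relation; the remaining goal is a formal identity for [lin_reduce]. *)
Lemma linear_consequence (c : K) (l r u v : X) :
  l = r -> u - v = c *: (l - r) -> u = v.
Proof. by move=> ->; rewrite subrr scaler0 => /eqP; rewrite subr_eq0 => /eqP. Qed.

End LinearExpressions.

Ltac lin_index env x :=
  match env with
  | x :: _ => constr:(0%N)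
  | _ :: ?env' => let n := lin_index env' x in constr:(n.+1)
  end.

Ltac lin_reify K env t :=
  match t with
  | (?a + ?b)%R =>
    let a' := lin_reify K env a in let b' := lin_reify K env b in
    constr:(LinAdd a' b')
  | (- ?a)%R => let a' := lin_reify K env a in constr:(LinOpp a')
  | (?c *: ?a)%R => let a' := lin_reify K env a in constr:(LinScale c a')
  | 0%R => constr:(LinZero K)
  | _ => let n := lin_index env t in constr:(LinVar K n)
  end.

Ltac lin_reduce K env :=
  match goal with
  | |- ?u = ?v =>
    let u' := lin_reify K env u in let v' := lin_reify K env v in
    apply: (@lin_eval_eq K _ env u' v')
  end.

Section Symmetrization.
Variables (K : fieldType) (M : superspace K) (X : lmodType K).
Hypotheses (two_neq0 : 2%:R != 0 :> K) (three_neq0 : 3%:R != 0 :> K).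
Local Notation sgn a b := ((-1) ^+ (a && b) : K).

Lemma trilinear_ext (f g : M -> M -> M -> X) : trilinear_map f -> trilinear_map g ->
  (forall a b c x y z, parity M a x -> parity M b y -> parity M c z ->
    f x y z = g x y z) -> forall x y z, f x y z = g x y z.
Proof.
move=> [f1 f2] [g1 g2] fg x y z; move: x.
apply: pproj_ext => [||a x px]; [exact: (f1 z).1 | exact: (g1 z).1|]; move: y.
apply: pproj_ext => [||b y py]; [exact: (f1 z).2 | exact: (g1 z).2|]; move: z.
apply: pproj_ext => [||c z pz]; [exact: (f2 x).2 | exact: (g2 x).2|].
exact: fg px py pz.
Qed.

Lemma trilinearD (f g : M -> M -> M -> X) : trilinear_map f -> trilinear_map g ->
  trilinear_map (fun x y z => f x y z + g x y z).
Proof.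
move=> [f1 f2] [g1 g2]; split=> w; split=> v a u u'.
- by rewrite (f1 w).1 (g1 w).1 scalerDr addrACA.
- by rewrite (f1 w).2 (g1 w).2 scalerDr addrACA.
- by rewrite (f2 w).1 (g2 w).1 scalerDr addrACA.
by rewrite (f2 w).2 (g2 w).2 scalerDr addrACA.
Qed.

Lemma trilinearZ c (f : M -> M -> M -> X) : trilinear_map f ->
  trilinear_map (fun x y z => c *: f x y z).
Proof.
move=> [f1 f2]; split=> w; split=> v a u u'.
- by rewrite (f1 w).1 scalerDr !scalerA mulrC.
- by rewrite (f1 w).2 scalerDr !scalerA mulrC.
- by rewrite (f2 w).1 scalerDr !scalerA mulrC.
by rewrite (f2 w).2 scalerDr !scalerA mulrC.
Qed.

(* On elements of parities a and b this is (-1)^(ab) h y x, since only the odd *)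
(* parts change sign.                                                          *)
Definition super_flip (h : M -> M -> X) (x y : M) : X :=
  h y x - 2%:R *: h (pproj true y) (pproj true x).

Lemma super_flipE h a b x y : bilinear_map h -> parity M a x -> parity M b y ->
  super_flip h x y = sgn a b *: h y x.
Proof.
move=> [hl hr] px py; rewrite /super_flip !(pproj_id _ px) !(pproj_id _ py).
case: a b px py => [] [] px py /=; rewrite ?(lin0 (hl _)) ?(lin0 (hr _)) ?scaler0 ?subr0;
  rewrite ?expr0 ?scale1r // expr1 scaleN1r.
by lin_reduce K [:: h y x]; split=> //=; ring.
Qed.

Definition flip12 (h : M -> M -> M -> X) x y z := super_flip (fun x y => h x y z) x y.
Definition flip23 (h : M -> M -> M -> X) x y z := super_flip (h x) y z.

Lemma flip12_trilinear h : trilinear_map h -> trilinear_map (flip12 h).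
Proof.
move=> [h1 h2]; have lp := @pproj_linear K M true.
split=> w; split=> v a u u'; rewrite /flip12 /super_flip ?lp.
- rewrite !(h1 _).2; lin_reduce K [:: h v u w; h v u' w; h (pproj true v) (pproj true u) w;
   h (pproj true v) (pproj true u') w]; do !split=> //=; ring.
- rewrite !(h1 _).1; lin_reduce K [:: h u v w; h u' v w; h (pproj true u) (pproj true v) w;
   h (pproj true u') (pproj true v) w]; do !split=> //=; ring.
- rewrite !(h1 _).1; lin_reduce K [:: h u w v; h u' w v; h (pproj true u) (pproj true w) v;
   h (pproj true u') (pproj true w) v]; do !split=> //=; ring.
rewrite !(h2 _).2; lin_reduce K [:: h v w u; h v w u'; h (pproj true v) (pproj true w) u;
   h (pproj true v) (pproj true w) u']; do !split=> //=; ring.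
Qed.

Lemma flip23_trilinear h : trilinear_map h -> trilinear_map (flip23 h).
Proof.
move=> [h1 h2]; have lp := @pproj_linear K M true.
split=> w; split=> v a u u'; rewrite /flip23 /super_flip ?lp.
- rewrite !(h1 _).1; lin_reduce K [:: h u w v; h u' w v; h u (pproj true w) (pproj true v);
   h u' (pproj true w) (pproj true v)]; do !split=> //=; ring.
- rewrite !(h2 _).2; lin_reduce K [:: h v w u; h v w u'; h v (pproj true w) (pproj true u);
   h v (pproj true w) (pproj true u')]; do !split=> //=; ring.
- rewrite !(h2 _).2; lin_reduce K [:: h w v u; h w v u'; h w (pproj true v) (pproj true u);
   h w (pproj true v) (pproj true u')]; do !split=> //=; ring.
rewrite !(h2 _).1; lin_reduce K [:: h w u v; h w u' v; h w (pproj true u) (pproj true v);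
   h w (pproj true u') (pproj true v)]; do !split=> //=; ring.
Qed.

Lemma flip12E h a b x y z : trilinear_map h -> parity M a x -> parity M b y ->
  flip12 h x y z = sgn a b *: h y x z.
Proof. by move=> th; apply: super_flipE; apply: th.1. Qed.

Lemma flip23E h b c x y z : trilinear_map h -> parity M b y -> parity M c z ->
  flip23 h x y z = sgn b c *: h x z y.
Proof. by move=> th; apply: super_flipE; apply: th.2. Qed.

Lemma sgnC a b : sgn a b = sgn b a.
Proof. by rewrite andbC. Qed.

Lemma sgn_sqr a b : sgn a b * sgn a b = 1.
Proof. by rewrite -expr2 sqrr_sign. Qed.

Definition super_alternating (h : M -> M -> M -> X) :=
  forall a b c x y z, parity M a x -> parity M b y -> parity M c z ->
    h x y z + sgn a (b (+) c) *: h y z x + sgn c (a (+) b) *: h z x y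
    - sgn a b *: h y x z - (-1) ^+ ((a && (b (+) c)) (+) (b && c)) *: h z y x
    - sgn b c *: h x z y = 0.

(* In the group algebra of S_3 generated by s = (12) and t = (23),             *)
(*   6 - (1 - s - t + st + ts - sts) = (1 + s)(3 - t + ts) + (1 + t)(2 - 2s).  *)
Lemma symmetric_decomposition h : trilinear_map h -> super_alternating h ->
  exists f g : M -> M -> M -> X, [/\ trilinear_map f, trilinear_map g,
    forall z, supersymmetric (fun x y => f x y z), forall x, supersymmetric (g x)
    & forall x y z, f x y z - g x y z = h x y z].
Proof.
move=> th ah; have six_neq0 : 6%:R != 0 :> K.
  by rewrite (natrM K 2 3) mulf_neq0.
(* [u] and [v] are h acted on by the cofactors of 1 + s and 1 + t; the factor 1 + s symmetrizes in
   the first two arguments, 1 + t in the last two. *)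
pose u x y z := 3%:R *: h x y z + -1 *: flip23 h x y z + flip23 (flip12 h) x y z.
pose v x y z := 2%:R *: h x y z + - 2%:R *: flip12 h x y z.
have t1 := flip12_trilinear th; have t2 := flip23_trilinear th.
have t3 := flip23_trilinear t1.
have tu : trilinear_map u.
  exact: (trilinearD (trilinearD (trilinearZ _ th) (trilinearZ _ t2)) t3).
have tv : trilinear_map v by exact: (trilinearD (trilinearZ _ th) (trilinearZ _ t1)).
pose f x y z := 6%:R^-1 *: (u x y z + flip12 u x y z).
pose g x y z := - 6%:R^-1 *: (v x y z + flip23 v x y z).
have tf : trilinear_map f.
  exact: (trilinearZ _ (trilinearD tu (flip12_trilinear tu))).
have tg : trilinear_map g.
  exact: (trilinearZ _ (trilinearD tv (flip23_trilinear tv))).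
exists f, g; split=> //.
- move=> z a b x y px py; rewrite /f !(flip12E _ tu px py) !(flip12E _ tu py px) (sgnC b a).
  rewrite [RHS]scalerA mulrC -scalerA; congr (_ *: _).
  by rewrite [RHS]scalerDr scalerA sgn_sqr scale1r addrC.
- move=> x a b y z py pz; rewrite /g !(flip23E _ tv py pz) !(flip23E _ tv pz py) (sgnC b a).
  rewrite [RHS]scalerA mulrC -scalerA; congr (_ *: _).
  by rewrite [RHS]scalerDr scalerA sgn_sqr scale1r addrC.
apply: trilinear_ext => //.
  have -> : (fun x y z => f x y z - g x y z) = (fun x y z => f x y z + -1 *: g x y z).
    by do 3![apply: functional_extensionality_dep => ?]; rewrite scaleN1r.
  exact: (trilinearD tf (trilinearZ _ tg)).
move=> a b c x y z px py pz.
(* By the group algebra identity, f - g - h is -1/6 times the alternating sum of h. *)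
apply: (linear_consequence (c := - 6%:R^-1) (ah a b c x y z px py pz)).
rewrite /f /g (flip12E _ tu px py) (flip23E _ tv py pz) /u /v.
rewrite !(flip23E _ th py pz) !(flip23E _ th px pz) !(flip23E _ t1 py pz).
rewrite !(flip23E _ t1 px pz) !(flip12E _ th px py) !(flip12E _ th px pz).
rewrite !(flip12E _ th py pz).
lin_reduce K [:: h x y z; h y z x; h z x y; h y x z; h z y x; h x z y].
case: a b c {px py pz} => [] [] [] /=; rewrite ?expr0 ?expr1; do !split; field;
  by rewrite ?six_neq0.
Qed.
End Symmetrization.

(** * The deformed product *)

Section GradedFiltration.
Variables (K : fieldType) (W : nat -> superspace K) (cm : component_product W).
Local Notation A := (gsum cm).

(** The bound is strict, so that [below 0] is the zero subspace and an error term of an element of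
    degree n is in [below n]. *)
Definition below_pred (n : nat) (f : A) :=
  forall k, (n <= k)%N -> dcoef (V := fun i => W i : lmodType K) k f = 0.
Fact below0 n : below_pred n 0. Proof. by []. Qed.
Fact belowL n a f g : below_pred n f -> below_pred n g -> below_pred n (a *: f + g).
Proof. by move=> pf pg k nk; rewrite dcoef_linear pf // pg // scaler0 addr0. Qed.
Definition below n : subspace A := Subspace (@below0 n) (@belowL n).

Lemma below_leq m n f : (m <= n)%N -> below m f -> below n f.
Proof. by move=> mn bf k nk; apply: bf; apply: leq_trans nk. Qed.

Lemma below_sinj n (x : W n) : below n.+1 (sinj x).
Proof. by move=> k nk; rewrite /sinj dcoef_dinj0 // neq_ltn nk. Qed.

(** Stating the degree condition pointwise avoids the truncated bound i + j - 1. *)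
Lemma belowM i j k f g : (forall a b, a < i -> b < j -> a + b < k)%N ->
  below i f -> below j g -> below k (smul f g).
Proof.
move=> ijk bf bg; apply: subspace_sum => a; apply: subspace_sum => b.
have [ia|ai] := leqP i a.
  by rewrite bf // (lin0 ((cprod_bilinear _ a b).1 _)); apply: subspace0.
have [jb|bj] := leqP j b.
  by rewrite bg // (lin0 ((cprod_bilinear _ a b).2 _)); apply: subspace0.
set u := dcoef _ _; set v := dcoef _ _; have [w _ ->] := cprod_degree cm u v.
by apply: below_leq (below_sinj w); apply: ijk.
Qed.

End GradedFiltration.

Section Trilinear.
Variables (K : fieldType) (M X : lmodType K).
Variables (p : M -> M -> M) (h : M -> M -> X).
Hypotheses (bp : bilinear_map p) (bh : bilinear_map h).

Lemma trilinear_compl : trilinear_map (fun x y z => h (p x y) z).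
Proof.
by split=> w; split=> v a u u'; rewrite ?bp.1 ?bp.2 ?bh.1 ?bh.2.
Qed.

Lemma trilinear_compr : trilinear_map (fun x y z => h x (p y z)).
Proof.
by split=> w; split=> v a u u'; rewrite ?bp.1 ?bp.2 ?bh.1 ?bh.2.
Qed.

End Trilinear.

(** The lifts are chosen separately for each value of the parameter; linearity in the parameter
    follows because products span S^2. *)
Lemma sym2_lift_param (K : fieldType) (M : superspace K) (X Y : lmodType K)
    (h : M -> M -> Y -> X) :
  (forall z, bilinear_map (fun x y => h x y z)) -> (forall x y, linear (h x y)) ->
  (forall z, supersymmetric (fun x y => h x y z)) ->
  exists P : sym_power M 2 -> Y -> X,
    bilinear_map P /\ forall x y z, P (sym_mul2 x y) z = h x y z.
Proof.
move=> bh lh sh.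
have ex z := cid (sym2_lift (bh z) (sh z)).
pose P s z := projT1 (ex z) s.
have lP z : linear (P^~ z) by have [] := projT2 (ex z).
have PE x y z : P (sym_mul2 x y) z = h x y z.
  by have [_ gE] := projT2 (ex z); apply: gE.
exists P; split=> //; split=> // s a u v; move: s.
have lr : linear (fun s => a *: P s u + P s v).
  by move=> c s t; rewrite !lP !scalerDr addrACA !scalerA mulrC.
by apply: (sym2_ind (P := equalizer (lP _) lr)) => x y /=; rewrite !PE lh.
Qed.

(** * The associator correction and the Akivis identity *)

Section AssociatorCorrection.
Variables (K : fieldType) (M : akivis_superalgebra K).
Hypotheses (two_neq0 : 2%:R != 0 :> K) (three_neq0 : 3%:R != 0 :> K).
Local Notation SP := (sym_power M).
Local Notation V := (V_algebra M).
Local Notation br := (@akivis_bracket K M).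
Local Notation sgn a b := ((-1) ^+ (a && b) : K).
Local Notation half := (2%:R^-1 : K).

Section Correction.
Variables (X : lmodType K) (j2 : SP 2 -> X) (j1 : M -> X).
Hypotheses (lj2 : linear j2) (lj1 : linear j1).

(* The associator of the product x * y = x y + [x, y] / 2 has to be corrected  *)
(* by this trilinear map to become A.                                          *)
Definition correction (x y z : M) : X :=
  j1 (akivis_triple x y z) + - half *: j2 (sym_mul2 (br x y) z)
  + half *: j2 (sym_mul2 x (br y z)) + - (half * half) *: j1 (br (br x y) z)
  + (half * half) *: j1 (br x (br y z)).

Lemma correction_trilinear : trilinear_map correction.
Proof.
have bb := akivis_bracket_bilinear M; have bm := sym_mul2_bilinear M.
have b2 : bilinear_map (fun x y => j2 (sym_mul2 x y)).
  by split=> w a u v; rewrite ?bm.1 ?bm.2 lj2.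
have b1 : bilinear_map (fun x y => j1 (br x y)).
  by split=> w a u v; rewrite ?bb.1 ?bb.2 lj1.
have [t1 t2 t3] := akivis_triple_trilinear M.
have t : trilinear_map (fun x y z => j1 (akivis_triple x y z)).
  by split=> w; split=> v a u u'; rewrite ?t1 ?t2 ?t3 lj1.
apply: (trilinearD _ (trilinearZ _ (trilinear_compr bb b1))).
apply: (trilinearD _ (trilinearZ _ (trilinear_compl bb b1))).
apply: (trilinearD _ (trilinearZ _ (trilinear_compr bb b2))).
exact: (trilinearD t (trilinearZ _ (trilinear_compl bb b2))).
Qed.

(** In the alternating sum the two [j2] terms cancel, as the product of S(M) is supercommutative.
    The double brackets add up to minus the Jacobi sum and the triple terms to the alternating sum
    of A, so the total vanishes by the Akivis identity. *)
Lemma correction_alternating : super_alternating correction.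
Proof.
move=> a b c x y z px py pz.
(* [R], [F2] and [F1] normalize all terms: inner brackets go to the left, and only [x,y], [y,z] and
   [z,x] remain. *)
have R a' b' c' x' y' z' : parity M a' x' -> parity M b' y' -> parity M c' z' ->
    correction x' y' z' = j1 (akivis_triple x' y' z')
      + - half *: j2 (sym_mul2 (br x' y') z')
      + half *: (sgn a' (b' (+) c') *: j2 (sym_mul2 (br y' z') x'))
      + - (half * half) *: j1 (br (br x' y') z')
      + (half * half) *: - (sgn a' (b' (+) c') *: j1 (br (br y' z') x')).
  move=> px' py' pz'; rewrite /correction.
  have pyz := akivis_bracket_parity py' pz'.
  rewrite (sym_mul2C px' pyz) (akivis_bracket_anticommutative px' pyz).
  by rewrite (linN lj1) (linZ lj1) (linZ lj2).
have F2 a' b' x' y' z' : parity M a' x' -> parity M b' y' ->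
    j2 (sym_mul2 (br y' x') z') = - (sgn b' a' *: j2 (sym_mul2 (br x' y') z')).
  move=> px' py'; rewrite (akivis_bracket_anticommutative py' px').
  have bl := (sym_mul2_bilinear M).1 z'.
  by rewrite (linN bl) (linZ bl) (linN lj2) (linZ lj2).
have F1 a' b' x' y' z' : parity M a' x' -> parity M b' y' ->
    j1 (br (br y' x') z') = - (sgn b' a' *: j1 (br (br x' y') z')).
  move=> px' py'; rewrite [in LHS](akivis_bracket_anticommutative py' px').
  have bl := (akivis_bracket_bilinear M).1 z'.
  by rewrite (linN bl) (linZ bl) (linN lj1) (linZ lj1).
have E := congr1 j1 (akivis_identity px py pz).
rewrite !(linB lj1) !(linD lj1) !(linZ lj1) in E.
apply: (linear_consequence (c := -1) E) => {E}.
rewrite (R _ _ _ _ _ _ px py pz) (R _ _ _ _ _ _ py pz px) (R _ _ _ _ _ _ pz px py).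
rewrite (R _ _ _ _ _ _ py px pz) (R _ _ _ _ _ _ pz py px) (R _ _ _ _ _ _ px pz py).
rewrite (F2 _ _ _ _ _ px py) (F2 _ _ _ _ _ py pz) (F2 _ _ _ _ _ pz px).
rewrite (F1 _ _ _ _ _ px py) (F1 _ _ _ _ _ py pz) (F1 _ _ _ _ _ pz px).
lin_reduce K [:: j1 (akivis_triple x y z); j1 (akivis_triple y z x);
  j1 (akivis_triple z x y); j1 (akivis_triple y x z); j1 (akivis_triple z y x);
  j1 (akivis_triple x z y); j2 (sym_mul2 (br x y) z); j2 (sym_mul2 (br y z) x);
  j2 (sym_mul2 (br z x) y); j1 (br (br x y) z); j1 (br (br y z) x); j1 (br (br z x) y)].
case: a b c {px py pz} => [] [] [] /=; rewrite ?expr0 ?expr1; do !split; field;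
  by rewrite ?two_neq0.
Qed.

End Correction.
End AssociatorCorrection.

Section VCoordinates.
Variables (K : fieldType) (M : superspace K).
Local Notation SP := (sym_power M).
Local Notation V := (V_algebra M).
Local Notation W := (tower 3 SP).

Definition v_product : component_product W :=
  @tower_product K 3 SP (fun i j _ => @sym_mul K M i j)
    (fun i j _ => @sym_mul_bilinear K M i j) (fun i j _ => @sym_mul_parity K M i j).

Definition vbelow (n : nat) : subspace V := below v_product n.

Definition vcoef k (le : (k < 3)%N) (f : V) : SP k.+1 :=
  scast (tower_base SP le) (dcoef (V := fun i => W i : lmodType K) k.+1 f).

Lemma vcoef_linear k le : linear (@vcoef k le).
Proof. by move=> a f g; rewrite /vcoef dcoef_linear scast_linear. Qed.

Lemma vcoef_vbase k (le : (k < 3)%N) s : vcoef le (vbase le s) = s.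
Proof. by rewrite /vcoef /vbase /sinj dcoef_dinj scastVK. Qed.

Lemma vcoef_sinj0 k (le : (k < 3)%N) n (x : W n) : n != k.+1 -> vcoef le (sinj x : V) = 0.
Proof. by move=> ne; rewrite /vcoef /sinj dcoef_dinj0 // (lin0 (scast_linear _)). Qed.

Lemma vcoef_below k (le : (k < 3)%N) (f : V) : vbelow k.+1 f -> vcoef le f = 0.
Proof. by move=> bf; rewrite /vcoef bf // (lin0 (scast_linear _)). Qed.

End VCoordinates.

Section Deformation.
Variables (K : fieldType) (M : akivis_superalgebra K).
Hypotheses (two_neq0 : 2%:R != 0 :> K) (three_neq0 : 3%:R != 0 :> K).
Local Notation SP := (sym_power M).
Local Notation V := (V_algebra M).
Local Notation T := (nonassociative_tensor_algebra M).
Local Notation br := (@akivis_bracket K M).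
Local Notation sgn a b := ((-1) ^+ (a && b) : K).
Local Notation half := (2%:R^-1 : K).

(** The deformation v w + c(v, w) uses half the bracket on M x M. For its associator on generators
    to be A, the value c(xy, z) - c(x, yz) must be [correction]. This is solvable because
    [correction] splits as f - g, with f a function of (xy, z) and g one of (x, yz). *)
Lemma deformation_exists : exists c : V -> V -> V,
  [/\ bilinear_map c, forall v, c (vunit M) v = 0 /\ c v (vunit M) = 0,
      forall v w, vbelow M 3%N (c v w) /\
        (vbelow M 2%N v -> vbelow M 2%N w -> vbelow M 2%N (c v w)),
      forall x y, c (vgen x) (vgen y) = half *: vgen (br x y)
    & forall x y z, c (smul (vgen x) (vgen y)) (vgen z)
        - c (vgen x) (smul (vgen y) (vgen z))
      = correction (@vgen2 K M) (@vgen K M) x y z].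
Proof.
(* Solving in the product of S^2 and M, embedded in V(M) by [e], makes it automatic that c takes
   values in degrees 1 and 2. *)
pose j2 (s : SP 2) : (SP 2 * M)%type := (s, 0).
pose j1 (m : M) : (SP 2 * M)%type := (0, m).
have lj2 : linear j2 by move=> a u v; congr pair; rewrite /= scaler0 addr0.
have lj1 : linear j1 by move=> a u v; congr pair; rewrite /= scaler0 addr0.
have l1 : linear (@vgen K M) := @vbase_linear K M 0 isT.
have l2 : linear (@vgen2 K M) := @vbase_linear K M 1 isT.
pose e (p : (SP 2 * M)%type) : V := vgen2 p.1 + vgen p.2.
have le : linear e by move=> a u v; rewrite /e /= l1 l2 scalerDr addrACA.
have ej2 s : e (j2 s) = vgen2 s by rewrite /e /= (lin0 l1) addr0.
have ej1 m : e (j1 m) = vgen m by rewrite /e /= (lin0 l2) add0r.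
have [f [g [tf tg sf sg fg]]] := symmetric_decomposition two_neq0 three_neq0
  (correction_trilinear lj2 lj1) (correction_alternating two_neq0 lj2 lj1).
(* [P] is f as a map on S^2 x M and gives c in degrees (2, 1); [Q] is g, with arguments reordered,
   and gives c in degrees (1, 2). *)
have [P [[Pl Pr] PE]] := sym2_lift_param tf.1 (fun x => (tf.2 x).2) sf.
have [Q [[Ql Qr] QE]] := @sym2_lift_param K M _ _ (fun y z x => g x y z)
  tg.2 (fun y z => (tg.1 z).1 y) sg.
pose p1 : V -> M := @vcoef K M 0 isT; pose p2 : V -> SP 2 := @vcoef K M 1 isT.
have lp1 : linear p1 := @vcoef_linear K M 0 isT.
have lp2 : linear p2 := @vcoef_linear K M 1 isT.
have p1g x : p1 (vgen x) = x by exact: (@vcoef_vbase K M 0 isT x).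
have p2g x : p2 (vgen x) = 0 by exact: (@vcoef_sinj0 K M 1 isT 1 _ isT).
have p1s s : p1 (vgen2 s) = 0 by exact: (@vcoef_sinj0 K M 0 isT 2 _ isT).
have p2s s : p2 (vgen2 s) = s by exact: (@vcoef_vbase K M 1 isT s).
have p1u : p1 (vunit M) = 0 by exact: (@vcoef_sinj0 K M 0 isT 0 _ isT).
have p2u : p2 (vunit M) = 0 by exact: (@vcoef_sinj0 K M 1 isT 0 _ isT).
have [bl brr] := akivis_bracket_bilinear M.
pose c v w := half *: vgen (br (p1 v) (p1 w)) + e (P (p2 v) (p1 w) + Q (p2 w) (p1 v)).
have eB s m : vbelow M 3%N (e (s, m)).
  apply: subspaceD; first exact: (@below_sinj _ _ (v_product M) 2).
  by apply: below_leq (@below_sinj _ _ (v_product M) 1 _).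
exists c; split.
- split=> [w a u v|w a u v]; rewrite /c lp1 lp2.
    rewrite bl Pl Qr l1 !(linD le) !(linZ le).
    lin_reduce K [:: vgen (br (p1 u) (p1 w)); vgen (br (p1 v) (p1 w));
      e (P (p2 u) (p1 w)); e (P (p2 v) (p1 w));
      e (Q (p2 w) (p1 u)); e (Q (p2 w) (p1 v))]; do !split=> //=; ring.
  rewrite brr Pr Ql l1 !(linD le) !(linZ le).
  lin_reduce K [:: vgen (br (p1 w) (p1 u)); vgen (br (p1 w) (p1 v));
    e (P (p2 w) (p1 u)); e (P (p2 w) (p1 v)); e (Q (p2 u) (p1 w));
    e (Q (p2 v) (p1 w))]; do !split=> //=; ring.
- move=> v; rewrite /c p1u p2u.
  rewrite (lin0 (bl _)) (lin0 (brr _)) (lin0 (Pl _)) (lin0 (Pr _)) (lin0 (Ql _)).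
  by rewrite (lin0 (Qr _)) (lin0 l1) addr0 (lin0 le) scaler0 addr0.
- move=> v w; have b1 m : vbelow M 2%N (vgen m) by exact: (@below_sinj _ _ (v_product M) 1).
  split=> [|v2 w2]; apply: subspaceD.
  + by apply/subspaceZ/(below_leq _ (b1 _)).
  + by case: (P _ _ + _) => s m; apply: eB.
  + exact: subspaceZ.
  have -> : p2 v = 0 by exact: (@vcoef_below K M 1 isT v v2).
  have -> : p2 w = 0 by exact: (@vcoef_below K M 1 isT w w2).
  by rewrite (lin0 (Pl _)) (lin0 (Ql _)) addr0 (lin0 le); apply: subspace0.
- by move=> x y; rewrite /c !p1g !p2g (lin0 (Pl _)) (lin0 (Ql _)) addr0 (lin0 le) addr0.
move=> x y z; rewrite /c !vgenM !p1g !p2g !p1s !p2s.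
rewrite (lin0 (bl _)) (lin0 (brr _)) (lin0 (Pl _)) (lin0 (Ql _)) (lin0 l1) scaler0.
rewrite addr0 !add0r PE QE -(linB le) fg /correction !(linD le) !(linZ le).
by rewrite !ej1 !ej2.
Qed.
End Deformation.

Section Coefficients.
Variables (K : fieldType) (W : nat -> superspace K).
Local Notation coef n f := (dcoef (V := fun i => W i : lmodType K) n f).

Lemma dcoef_sinj n (x : W n) : coef n (sinj x) = x.
Proof. exact: (@dcoef_dinj _ _ (fun i => W i : lmodType K)). Qed.

Lemma dcoef_sinj0 m n (x : W m) : m != n -> coef n (sinj x) = 0.
Proof. exact: (@dcoef_dinj0 _ _ (fun i => W i : lmodType K)). Qed.

End Coefficients.

(** * Linear maps preserving degree and parity *)

Section GradedMaps.
Variables (K : fieldType) (W W' : nat -> superspace K).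
Variable F : dsum_superspace W -> dsum_superspace W'.
Hypotheses (lF : linear F) (dF : forall n (x : W n), dsum_degree W' n (F (sinj x))).
Local Notation coef n f := (dcoef (V := fun i => W i : lmodType K) n f).
Local Notation coef' n f := (dcoef (V := fun i => W' i : lmodType K) n f).

Lemma graded_map_coef n t : sinj (coef' n (F t)) = F (sinj (coef n t)).
Proof.
have lc := @dcoef_linear K _ (fun i => W i : lmodType K) n.
have lc' := @dcoef_linear K _ (fun i => W' i : lmodType K) n.
have l1 := linear_comp (@sinj_linear _ W' n) (linear_comp lc' lF).
have l2 := linear_comp lF (linear_comp (@sinj_linear _ W n) lc).
move: t; apply: (dsum_ext l1 l2) => k x /=; rewrite -/(sinj (W := W) x).
have [e|ne] := eqVneq k n.
  subst k; have [y _ e] := dF x.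
  by rewrite dcoef_sinj e dcoef_sinj.
have [y _ ->] := dF x.
by rewrite !dcoef_sinj0 // (lin0 (@sinj_linear _ W n)) (lin0 lF) (lin0 (@sinj_linear _ W' n)).
Qed.

Lemma graded_map_inj : (forall n (x : W n), F (sinj x) = 0 -> x = 0) -> injective F.
Proof.
move=> iF t u e; apply/dsumP => n; apply/eqP; rewrite -subr_eq0; apply/eqP.
have lc := @dcoef_linear K _ (fun i => W i : lmodType K) n.
apply: iF; rewrite -(linB lc) -graded_map_coef (linB lF) e subrr.
exact: (lin0 (@sinj_linear _ W' n)).
Qed.

Lemma graded_map_degree n t : injective F ->
  dsum_degree W n t <-> dsum_degree W' n (F t).
Proof.
move=> iF; case: n => n; last first.
  by split=> [->|e]; [exact: (lin0 lF) | apply: iF; rewrite e (lin0 lF)].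
split=> [[x _ ->]|[y _ e]]; first exact: dF.
exists (coef n t) => //; apply: iF; rewrite -graded_map_coef e.
by rewrite dcoef_sinj.
Qed.

End GradedMaps.

(** If F v has parity a, then F sends the component of v of the other parity to the corresponding
    component of F v, which is 0; injectivity kills it. *)
Lemma injective_parity (K : fieldType) (V V' : superspace K) (F : V -> V') :
  linear F -> injective F -> (forall a v, parity V a v -> parity V' a (F v)) ->
  forall a v, parity V a v <-> parity V' a (F v).
Proof.
move=> lF iF pF a v; split=> [|pv]; first exact: pF.
have z : pproj (~~ a) v = 0.
  apply: iF; rewrite (lin0 lF); have := pproj_id (~~ a) pv.
  have [e0 e1] := pproj_eq (pF _ _ (pprojP false v)) (pF _ _ (pprojP true v)).
  rewrite -(linD lF) -pprojD in e0 e1.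
  by case: a pv => _ e; [rewrite -e0 | rewrite -e1]; exact: e.
rewrite [v]pprojD; case: a z {pv} => /= ->; rewrite ?add0r ?addr0; exact: pprojP.
Qed.

(** * The map from the free algebra that kills the enveloping ideal *)

Section Leading.
Variables (K : fieldType) (M : akivis_superalgebra K).
Hypotheses (two_neq0 : 2%:R != 0 :> K) (three_neq0 : 3%:R != 0 :> K).
Local Notation SP := (sym_power M).
Local Notation V := (V_algebra M).
Local Notation W := (tower 3 SP).
Local Notation T := (nonassociative_tensor_algebra M).
Local Notation br := (@akivis_bracket K M).
Local Notation half := (2%:R^-1 : K).

(** Phi is the homomorphism from T(M) to V(M) with the deformed product, so its kernel is an ideal
    and only the two families of relations need checking. *)
Lemma deformed_map : exists Phi : T -> V,
  [/\ linear Phi, forall t, enveloping_ideal M t -> Phi t = 0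
    & exists c : V -> V -> V,
      [/\ forall v w, vbelow M 3%N (c v w)
            /\ (vbelow M 2%N v -> vbelow M 2%N w -> vbelow M 2%N (c v w)),
          Phi (tunit M) = vunit M, forall x, Phi (tgen x) = vgen x
        & forall x y, Phi (smul x y) = smul (Phi x) (Phi y) + c (Phi x) (Phi y)]].
Proof.
have [c [[cl cr] cu cb cg ca]] := deformation_exists M two_neq0 three_neq0.
have [ml mr] := smul_bilinear V.
pose star (v w : V) : V := smul v w + c v w.
have lg : linear (@vgen K M) := @vbase_linear K M 0 isT.
have bs : bilinear_map star.
  by split=> w a u v; rewrite /star ?ml ?mr ?cl ?cr scalerDr addrACA.
have s1 v : star (vunit M) v = v.
  by rewrite /star (cu v).1 addr0; exact: graded_unitl.
have sr1 v : star v (vunit M) = v.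
  by rewrite /star (cu v).2 addr0; exact: graded_unitr.
have [Phi [lPhi Phi1 Phig PhiM]] := free_algebra_lift bs s1 sr1 lg.
exists Phi; split=> //; last by exists c.
move=> t /(_ (preimage_subspace lPhi (zero_subspace V))); apply.
  move=> x y /= Px; rewrite !PhiM Px; split.
    exact: (lin0 (bs.1 _)).
  exact: (lin0 (bs.2 _)).
move=> _ [a b x y px py|a b d x y z px py pz] /=.
  (* In the supercommutator the products cancel and the two half brackets add up to [x, y]. *)
  rewrite !(linB lPhi) (linZ lPhi) !PhiM !Phig /star !cg (vgenC py px).
  rewrite (akivis_bracket_anticommutative py px) (linN lg) (linZ lg).
  lin_reduce K [:: smul (vgen x) (vgen y); vgen (br x y)].
  by case: a b {px py} => [] [] /=; rewrite ?expr0 ?expr1; do !split; field.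
(* The undeformed products of three generators cancel by [vgenA]; what remains is the equation
   defining [correction]. *)
rewrite !(linB lPhi) !PhiM !Phig /star !cg !(linD (ml _)) !(linD (mr _)).
rewrite !(linD (cl _)) !(linD (cr _)) !(linZ (ml _)) !(linZ (mr _)).
rewrite !(linZ (cl _)) !(linZ (cr _)) !cg vgenA.
apply: (linear_consequence (c := 1) (ca x y z)); rewrite /correction -!vgenM.
lin_reduce K [:: smul (vgen x) (smul (vgen y) (vgen z)); smul (vgen (br x y)) (vgen z);
  smul (vgen x) (vgen (br y z)); c (smul (vgen x) (vgen y)) (vgen z);
  c (vgen x) (smul (vgen y) (vgen z)); vgen (br (br x y) z); vgen (br x (br y z));
  vgen (akivis_triple x y z)].
by do !split=> //=; field.
Qed.
End Leading.

(** * The comparison map *)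

Section FreeComponents.
Variables (K : fieldType) (M : superspace K).
Local Notation T := (nonassociative_tensor_algebra M).
Local Notation W := (tower 1 (fun=> M)).
Local Notation coef n f := (dcoef (V := fun i => W i : lmodType K) n f).

Lemma tensor_filtration_sinj n (x : W n) : tensor_filtration M n (sinj x).
Proof. by move=> k nk; rewrite dcoef_sinj0 // neq_ltn nk. Qed.

Lemma tensor_filtration_ind n (P : subspace T) :
  (forall k (x : W k), (k <= n)%N -> P (sinj x)) ->
  forall t, tensor_filtration M n t -> P t.
Proof.
move=> Pn t ft; rewrite (dsum_decomp t); apply: subspace_sum => k.
have [kn|nk] := leqP k n; first exact: Pn.
by rewrite ft // (lin0 (@dinj_linear _ _ (fun i => W i : lmodType K) k)); apply: subspace0.
Qed.

Lemma tensor_filtration_top n t : tensor_filtration M n.+1 t ->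
  tensor_filtration M n (t - sinj (coef n.+1 t)).
Proof.
move=> ft k nk; have lc := @dcoef_linear K _ (fun i => W i : lmodType K) k.
rewrite (linB lc); case: (ltngtP k n.+1) => [|lt|->].
- by rewrite ltnS leqNgt nk.
- by rewrite ft // dcoef_sinj0 ?subr0 // neq_ltn lt.
by rewrite dcoef_sinj subrr.
Qed.

Definition free_mul i j (x : W i.+1) (y : W j.+1) : W (i + j).+2 :=
  tower_mul (@no_mul K M) x y.

Lemma free_mulE i j (x : W i.+1) (y : W j.+1) :
  smul (sinj x : T) (sinj y) = sinj (free_mul x y).
Proof. exact: gsum_mul_sinj. Qed.

End FreeComponents.

Section SymbolMap.
Variables (K : fieldType) (M : superspace K).
Local Notation V := (V_algebra M).
Local Notation T := (nonassociative_tensor_algebra M).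
Local Notation W := (tower 1 (fun=> M)).

Lemma symbol_map : exists pi : T -> V,
  [/\ linear pi, pi (tunit M) = vunit M, forall x, pi (tgen x) = vgen x
    & forall x y, pi (smul x y) = smul (pi x) (pi y)].
Proof.
apply: free_algebra_lift.
- exact: smul_bilinear.
- exact: graded_unitl.
- exact: graded_unitr.
exact: (@vbase_linear K M 0 isT).
Qed.

Variable pi : T -> V.
Hypotheses (lpi : linear pi) (pi1 : pi (tunit M) = vunit M).
Hypotheses (pig : forall x, pi (tgen x) = vgen x).
Hypothesis (piM : forall x y, pi (smul x y) = smul (pi x) (pi y)).

Lemma symbol_surj v : exists t, pi t = v.
Proof.
pose P := image_subspace lpi (full_subspace T).
suff [t _ ->] : P v by exists t.
apply: (V_algebra_ind (P := P)) => [|x|x y [t _ ->] [u _ ->]].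
- by exists (tunit M).
- by exists (tgen x).
by exists (smul t u); rewrite ?piM.
Qed.

Lemma symbol_degree n (x : W n) : zdegree V n (pi (sinj x)).
Proof.
move: n x; pose P n := preimage_subspace (@sinj_linear _ W n)
  (preimage_subspace lpi (zdegree V n)).
apply: (free_component_ind (P := P)) => [a|x|i j x y Px Py] /=.
- rewrite (sinj0E (tower0 1 (fun=> M))) (linZ lpi) [X in _ *: X]pi1.
  by apply: (subspaceZ (P := zdegree V 0%N));
    exists (scast (esym (tower0 3 (sym_power M))) (1 : K^o)).
- rewrite -/(tgen x) pig; by exists (scast (esym (tower_base (sym_power M) (isT : 0 < 3)%N)) x).
rewrite -/(free_mul x y) -free_mulE piM.
by have := zdegree_mul Px Py; rewrite -PoszD addSn addnS.
Qed.

Lemma degree_below n v : zdegree V (Posz n) v -> vbelow M n.+1 v.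
Proof. by move=> [x _ ->]; exact: (@below_sinj _ _ (v_product M)). Qed.

Section LeadingTerm.
Variables (Phi : T -> V) (c : V -> V -> V).
Hypotheses (lPhi : linear Phi) (Phi1 : Phi (tunit M) = vunit M).
Hypothesis Phig : forall x, Phi (tgen x) = vgen x.
Hypothesis PhiM : forall x y, Phi (smul x y) = smul (Phi x) (Phi y) + c (Phi x) (Phi y).
Hypothesis c_below : forall v w, vbelow M 3%N (c v w) /\
  (vbelow M 2%N v -> vbelow M 2%N w -> vbelow M 2%N (c v w)).

Let lD : linear (fun t => Phi t - pi t).
Proof. by move=> a u v; rewrite lPhi lpi scalerBr opprD addrACA. Qed.

Let Phi_below n (x : W n) : vbelow M n (Phi (sinj x) - pi (sinj x)) ->
  vbelow M n.+1 (Phi (sinj x)).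
Proof.
move=> b; rewrite -[Phi _](subrK (pi (sinj x))); apply: subspaceD.
  exact: below_leq b.
exact/degree_below/symbol_degree.
Qed.

(** By induction on products: Phi and pi multiply alike up to c, so the error of a product is a sum
    of products containing one smaller error, plus a value of c. *)
Lemma leading_term n (x : W n) : vbelow M n (Phi (sinj x) - pi (sinj x)).
Proof.
move: n x; pose P n := preimage_subspace (@sinj_linear _ W n)
  (preimage_subspace lD (vbelow M n)).
apply: (free_component_ind (P := P)) => [a|x|i j x y Px Py] /=.
- rewrite (sinj0E (tower0 1 (fun=> M))) (linZ lPhi) (linZ lpi) pi1 Phi1 subrr.
  exact: (subspace0 (vbelow M 0%N)).
- rewrite -/(tgen x) pig Phig subrr; exact: (subspace0 (vbelow M 1%N)).
rewrite -/(free_mul x y) -free_mulE piM PhiM.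
have [ml mr] := smul_bilinear V.
have bx := Phi_below Px; have by_ := Phi_below Py.
have -> : smul (Phi (sinj x)) (Phi (sinj y)) + c (Phi (sinj x)) (Phi (sinj y))
    - smul (pi (sinj x)) (pi (sinj y))
  = smul (Phi (sinj x) - pi (sinj x)) (Phi (sinj y))
    + smul (pi (sinj x)) (Phi (sinj y) - pi (sinj y)) + c (Phi (sinj x)) (Phi (sinj y)).
  by rewrite (linB (ml _)) (linB (mr _)) addrA subrK addrAC.
apply: (subspaceD (P := vbelow M _)); first apply: (subspaceD (P := vbelow M _)).
- by apply: (belowM _ Px by_) => a b; lia.
- by apply: (belowM _ (degree_below (symbol_degree x)) Py) => a b; lia.
have [b3 b2] := c_below (Phi (sinj x)) (Phi (sinj y)).
(* From total degree 3 on, the bound [b3] on c suffices; in degree 2 both factors are images of M,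
   and the sharper bound [b2] applies. *)
case: i j x y bx by_ b3 b2 {Px Py} => [|i] [|j] x y bx by_ b3 b2; first exact: b2.
- exact: below_leq b3.
- exact: below_leq b3.
exact: below_leq b3.
Qed.

Lemma deformed_below n t : tensor_filtration M n t -> vbelow M n.+1 (Phi t).
Proof.
apply: (tensor_filtration_ind (P := preimage_subspace lPhi (vbelow M n.+1))) => k x kn.
exact: below_leq (Phi_below (leading_term x)).
Qed.

End LeadingTerm.
End SymbolMap.

Section ClassMap.
Variables (K : fieldType) (M : akivis_superalgebra K).
Local Notation T := (nonassociative_tensor_algebra M).
Local Notation W := (tower 1 (fun=> M : superspace K)).
Local Notation G := (gr_algebra M).
Local Notation U := (enveloping_algebra M).

Fact env_sinj_subproof n (x : W n) : env_filtration M n (env_class (sinj x : T)).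
Proof. by exists (sinj x); first exact: tensor_filtration_sinj. Qed.

Definition gr_class n : W n -> gr M n :=
  match n return W n -> gr M n with
  | 0%N => fun a => scalar_of (tower0 1 (fun=> M : superspace K)) a
  | k.+1 => fun x => qpi (env_previous M k) (insubspace (env_sinj_subproof x))
  end.

Lemma gr_class_linear n : linear (@gr_class n).
Proof.
case: n => [|n] a x y; first exact: scast_linear.
rewrite /= -(qpi_linear (env_previous M n)); congr qpi; apply: val_inj.
rewrite [RHS](@subspace_val_linear _ _ (env_filtration M n.+1)) !val_insubspace.
by rewrite -env_class_linear -sinj_linear.
Qed.

Lemma gr_classM i j (x : W i.+1) (y : W j.+1) :
  gr_class (free_mul x y) = gr_mul (gr_class x : gr M i.+1) (gr_class y).
Proof.
rewrite /= gr_mulE; congr qpi; apply: val_inj.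
by rewrite !val_insubspace -free_mulE env_classM.
Qed.

Lemma gr_class_eq0 n (x : W n.+1) : gr_class x = 0 <->
  exists2 t, tensor_filtration M n t & enveloping_ideal M (sinj x - t).
Proof.
split=> [/qpi0 [t ft /qpi_eq e]|[t ft e]]; first by exists t.
by apply/qpi0; exists t => //; apply/qpi_eq.
Qed.

(** A class in degree n + 1 is represented by the top component of any lift to T(M), because the
    other components have filtration n. *)
Lemma gr_class_surj n (g : gr M n) : exists x : W n, gr_class x = g.
Proof.
case: n g => [|n] g.
  by exists (scast (esym (tower0 1 (fun=> M : superspace K))) g); exact: scastVK.
rewrite -[g]qreprK; case: (subspace_valP (qrepr g)) => t ft e.
exists (dcoef (V := fun i => W i : lmodType K) n.+1 t); apply/qpi_eq.
exists (sinj (dcoef (V := fun i => W i : lmodType K) n.+1 t) - t).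
  by rewrite -opprB; apply/subspaceN/tensor_filtration_top.
rewrite (linB (@subspace_val_linear _ _ (env_filtration M n.+1))) e.
by rewrite (linB (@env_class_linear _ M)).
Qed.

Definition gr_unit : G := graded_unit (W := gr M) erefl.

Lemma gr_smulE i j (g : gr M i.+1) (h : gr M j.+1) :
  smul (sinj g : G) (sinj h) = sinj (gr_mul g h).
Proof. exact: gsum_mul_sinj. Qed.

Definition tgen1 (x : M) : W 1 :=
  scast (esym (@tower_base K 1 (fun=> M : superspace K) 0 isT)) x.

Definition gr_gen (x : M) : G := sinj (gr_class (tgen1 x)).

Lemma gr_gen_linear : linear gr_gen.
Proof. by move=> a x y; rewrite /gr_gen /tgen1 scast_linear gr_class_linear sinj_linear. Qed.

Lemma gr_gen_parity a x : parity M a x -> parity G a (gr_gen x).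
Proof.
move=> px; apply: sinj_parity; exists (insubspace (env_sinj_subproof (tgen1 x))) => //.
by apply: env_class_parity; apply: tgen_parity.
Qed.

Lemma tensor_filtration_tgen n (x : M) : (0 < n)%N -> tensor_filtration M n (tgen x).
Proof.
move=> n0 k nk; apply: (@tensor_filtration_sinj _ _ 1 (tgen1 x)).
exact: leq_ltn_trans nk.
Qed.

(** Modulo the ideal the supercommutator is [x, y], which has filtration 1 and so vanishes in degree
    2. *)
Lemma gr_genC : supersymmetric (fun x y => smul (gr_gen x) (gr_gen y)).
Proof.
move=> a b x y px py; rewrite !gr_smulE -!gr_classM -(linZ (@sinj_linear _ (gr M) 2)).
rewrite -(linZ (@gr_class_linear 2)); congr sinj; apply/eqP.
rewrite -subr_eq0 -(linB (@gr_class_linear 2)); apply/eqP/gr_class_eq0.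
exists (tgen (akivis_bracket x y)); first exact: tensor_filtration_tgen.
rewrite (linB (@sinj_linear _ W 2)) (linZ (@sinj_linear _ W 2)).
rewrite -(free_mulE (tgen1 x) (tgen1 y)) -(free_mulE (tgen1 y) (tgen1 x)).
exact/mem_ideal_gen/CommutatorRel.
Qed.

Lemma gr_genA x y z : smul (smul (gr_gen x) (gr_gen y)) (gr_gen z)
  = smul (gr_gen x) (smul (gr_gen y) (gr_gen z)).
Proof.
have [ml mr] := smul_bilinear G; have lg := gr_gen_linear.
have bG : bilinear_map (fun x y => smul (gr_gen x) (gr_gen y)).
  by split=> w a u v; rewrite lg ?ml ?mr.
have tl : trilinear_map (fun x y z => smul (smul (gr_gen x) (gr_gen y)) (gr_gen z)).
  by split=> w; split=> v a u u'; rewrite lg ?ml ?mr ?ml ?mr.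
have tr : trilinear_map (fun x y z => smul (gr_gen x) (smul (gr_gen y) (gr_gen z))).
  by split=> w; split=> v a u u'; rewrite lg ?ml ?mr ?ml ?mr.
(* The associator relation is imposed on homogeneous elements only, so trilinearity reduces the
   claim to these. *)
move: x y z; apply: (trilinear_ext tl tr) => a b c x y z px py pz.
rewrite !gr_smulE -!gr_classM.
congr (@sinj _ (gr M) 3); apply/eqP.
rewrite -subr_eq0 -(linB (@gr_class_linear 3)); apply/eqP/gr_class_eq0.
exists (tgen (akivis_triple x y z)); first exact: tensor_filtration_tgen.
rewrite (linB (@sinj_linear _ W 3)).
rewrite -(@free_mulE _ _ 1 0 (free_mul (tgen1 x) (tgen1 y)) (tgen1 z)).
rewrite -(@free_mulE _ _ 0 1 (tgen1 x) (free_mul (tgen1 y) (tgen1 z))).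
rewrite -(free_mulE (tgen1 x) (tgen1 y)) -(free_mulE (tgen1 y) (tgen1 z)).
by apply/mem_ideal_gen; apply: (AssociatorRel px py pz).
Qed.

Lemma gr_map_exists : exists rho : V_algebra M -> G,
  [/\ linear rho, rho (vunit M) = gr_unit, forall x, rho (vgen x) = gr_gen x
    & forall x y, rho (smul x y) = smul (rho x) (rho y)].
Proof.
apply: V_algebra_lift.
- exact: smul_bilinear.
- exact: graded_unitl.
- exact: graded_unitr.
- exact: gr_gen_linear.
- exact: gr_genC.
exact: gr_genA.
Qed.

(** * The map rho is bijective and preserves both gradings *)

Section Comparison.
Variables (rho : V_algebra M -> G) (pi : T -> V_algebra M).
Hypotheses (lrho : linear rho) (rho1 : rho (vunit M) = gr_unit).
Hypothesis (rhog : forall x, rho (vgen x) = gr_gen x).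
Hypothesis (rhoM : forall x y, rho (smul x y) = smul (rho x) (rho y)).
Hypotheses (lpi : linear pi) (pi1 : pi (tunit M) = vunit M).
Hypotheses (pig : forall x, pi (tgen x) = vgen x).
Hypothesis (piM : forall x y, pi (smul x y) = smul (pi x) (pi y)).
Local Notation V := (V_algebra M).
Local Notation VW := (tower 3 (sym_power M)).

Lemma comparison n (x : W n) : rho (pi (sinj x)) = sinj (gr_class x).
Proof.
move: n x; pose P n := equalizer
  (linear_comp lrho (linear_comp lpi (@sinj_linear _ W n)))
  (linear_comp (@sinj_linear _ (gr M) n) (@gr_class_linear n)).
apply: (free_component_ind (P := P)) => [a|x|i j x y Px Py].
- rewrite /= (sinj0E (tower0 1 (fun=> M : superspace K))) (linZ lpi) (linZ lrho).
  by rewrite [X in rho X]pi1 rho1 [RHS](@sinj0E _ (gr M) erefl).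
- by rewrite /= -/(tgen x) pig rhog.
change (rho (pi (sinj (free_mul x y))) = sinj (gr_class (free_mul x y))).
have {}Px : rho (pi (sinj x)) = sinj (gr_class x) := Px.
have {}Py : rho (pi (sinj y)) = sinj (gr_class y) := Py.
by rewrite -free_mulE piM rhoM Px Py gr_smulE -gr_classM.
Qed.

Lemma symbol_component n (v : VW n) : exists x : W n, pi (sinj x) = sinj v.
Proof.
have [t e] := symbol_surj lpi pi1 pig piM (sinj v : V).
exists (dcoef (V := fun i => W i : lmodType K) n t).
have dpi k (x : W k) := symbol_degree lpi pi1 pig piM x.
by rewrite -(graded_map_coef lpi dpi) e dcoef_sinj.
Qed.

Lemma rho_degree n (v : VW n) : dsum_degree (gr M) n (rho (sinj v)).
Proof.
have [x <-] := symbol_component v; rewrite comparison.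
by exists (gr_class x).
Qed.

Lemma rho_surj g : exists v, rho v = g.
Proof.
suff [v _ ->] : image_subspace lrho (full_subspace V) g by exists v.
move: g; apply: dsum_ind => n g; have [x <-] := gr_class_surj g.
by rewrite -/(sinj (gr_class x)) -comparison; exists (pi (sinj x)).
Qed.

(** The elements whose two parity components are sent to elements of the same parity form a subspace
    that is closed under products and contains the unit and the generators. *)
Lemma rho_parity a v : parity V a v -> parity G a (rho v).
Proof.
pose homog (v : V) := forall a, parity G a (rho (pproj a v)).
have lr b : linear (fun v => rho (pproj b v)).
  exact: (linear_comp lrho (@pproj_linear K V b)).
have homog0 : homog 0 by move=> b; rewrite (lin0 (lr b)); apply: subspace0.
have homogL c u w : homog u -> homog w -> homog (c *: u + w).
  by move=> hu hw b; rewrite (lr b); apply: subspaceL.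
suff Hv : homog v by move=> pv; have := Hv a; rewrite (pproj_id a pv) eqxx.
have hp b u : parity V b u -> parity G b (rho u) -> homog u.
  move=> pu pr d; rewrite (pproj_id d pu); case: eqP => [->|_] //.
  by rewrite (lin0 lrho); apply: subspace0.
apply: (V_algebra_ind (P := Subspace homog0 homogL)) => [|x|x y hx hy].
- apply: (hp false); first exact: graded_unit_parity.
  by rewrite rho1; apply: graded_unit_parity.
- rewrite [x]pprojD; have lg : linear (@vgen K M) := @vbase_linear K M 0 isT.
  rewrite (linD lg); apply: (subspaceD (P := Subspace homog0 homogL)).
    apply: (hp false); first exact/vgen_parity/pprojP.
    rewrite rhog; exact/gr_gen_parity/pprojP.
  apply: (hp true); first exact/vgen_parity/pprojP.
  rewrite rhog; exact/gr_gen_parity/pprojP.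
have [ml mr] := smul_bilinear V.
have hm b d : homog (smul (pproj b x) (pproj d y)).
  apply: (hp (b (+) d)); first by apply: smul_parity; apply: pprojP.
  by rewrite rhoM; apply: smul_parity; [apply: hx | apply: hy].
rewrite [x]pprojD [y]pprojD !(linD (ml _)) !(linD (mr _)).
by do !apply: (subspaceD (P := Subspace homog0 homogL)); apply: hm.
Qed.

Hypotheses (two_neq0 : 2%:R != 0 :> K) (three_neq0 : 3%:R != 0 :> K).

(** Lift v to x in T(M). If its class is 0, then Phi x equals the image of an element of lower
    filtration, so the leading term pi x of Phi x, which is v, vanishes. *)
Lemma rho_component_inj n (v : VW n) : rho (sinj v) = 0 -> v = 0.
Proof.
have [x ex] := symbol_component v; rewrite -ex comparison => r0.
have {r0} c0 : gr_class x = 0.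
  by apply: (@sinj_inj _ (gr M) n); rewrite r0 (lin0 (@sinj_linear _ (gr M) n)).
suff px : vbelow M n (pi (sinj x)).
  by rewrite -(dcoef_sinj v) -ex px.
(* Degree 0 is separate: there gr is K itself and the class of x is the scalar x. *)
case: n x v ex c0 => [|n] x v _ c0.
  rewrite (scalar_of_inj (c0 : scalar_of (tower0 1 (fun=> M : superspace K)) x = 0)).
  rewrite (lin0 (@sinj_linear _ W 0)) (lin0 lpi).
  exact: (subspace0 (vbelow M 0%N)).
have [t ft It] := (gr_class_eq0 x).1 c0.
have [Phi [lPhi Phi0 [c [cb Phi1 Phig PhiM]]]] := deformed_map M two_neq0 three_neq0.
have := Phi0 _ It; rewrite (linB lPhi) => /eqP; rewrite subr_eq0 => /eqP e.
have := leading_term lpi pi1 pig piM lPhi Phi1 Phig PhiM cb x.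
have := deformed_below lpi pi1 pig piM lPhi Phi1 Phig PhiM cb ft; rewrite -e => b1 b2.
rewrite -[pi _](subKr (Phi (sinj x))).
exact: (subspaceB (P := vbelow M n.+1)).
Qed.

End Comparison.
End ClassMap.

Theorem theorem1 (K : fieldType) (hchar2 : 2%N \notin [pchar K])
    (hchar3 : 3%N \notin [pchar K]) (M : akivis_superalgebra K) :
  zgraded_isomorphic (V_algebra M) (gr_algebra M).
Proof.
have two_neq0 : 2%:R != 0 :> K by move: hchar2; rewrite inE.
have three_neq0 : 3%:R != 0 :> K by move: hchar3; rewrite inE.
have [pi [lpi pi1 pig piM]] := symbol_map M.
have [rho [lrho rho1 rhog rhoM]] := gr_map_exists M.
have drho := rho_degree lrho rho1 rhog rhoM lpi pi1 pig piM.
have irho : injective rho.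
  apply: (graded_map_inj lrho drho) => n v.
  exact: (rho_component_inj lrho rho1 rhog rhoM lpi pi1 pig piM).
exists rho; split=> //.
- have sr := rho_surj lrho rho1 rhog rhoM lpi pi1 pig piM.
  exists (fun g => projT1 (cid (sr g))) => [v|g]; last by case: cid.
  by apply: irho; case: cid.
- apply: (injective_parity lrho irho); exact: rho_parity.
by move=> n v; exact: graded_map_degree.
Qed.
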